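(* Let $k\ge 4$ and $0<d<n$. If $H$ is a $k$-graph on $n$ vertices with $\Delta_{k-2}(H)\le dn$, then $$\alpha(H)=\Omega\left(\left(\frac nd\,\log\log\frac nd\right)^{\frac1{k-1}}\right).$$
   Context: A $k$-graph ($k$-uniform hypergraph) $H$ consists of a finite vertex set $V(H)$ and an edge set, which is a family of $k$-element subsets of $V(H)$. An independent set is a set of vertices containing no edge, and $\alpha(H)$ is the size of a largest independent set. For $S\subseteq V(H)$, $\deg_H(S)$ is the number of edges of $H$ containing $S$; $\Delta_\ell(H)$ is the maximum of $\deg_H(S)$ over all $\ell$-element subsets $S$ of $V(H)$. All logarithms are natural. The notation $\Omega$ is the standard asymptotic one with $n\to\infty$, where $k$ is fixed and the implied constant depends only on $k$; a negative value of $\log\log\frac nd$ is read as $0$.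
   Formalization: The hypothesis dn ≥ 1 is added; for real d the claim fails for edgeless H (α(H)=n while the bound tends to infinity as d→0). It is automatic once H has an edge, since then 1 ≤ Δ_{k-2}(H) ≤ dn, so only edgeless H with dn < 1 are excluded. *)

(* Defs.v *)
From mathcomp Require Import all_boot all_order all_algebra.
From mathcomp Require Import reals exp.

Set Implicit Arguments.
Unset Strict Implicit.
Unset Printing Implicit Defensive.

Import Order.TTheory GRing.Theory Num.Theory.

Record kgraph (k : nat) (V : finType) := KGraph {
  edges : {set {set V}};
  edges_uniform : [forall e in edges, #|e| == k]
}.

Section Hypergraph.
Variables (k : nat) (V : finType) (H : kgraph k V).

Definition independent (A : {set V}) : bool :=
  [forall e in edges H, ~~ (e \subset A)].

Definition alpha : nat := \max_(A : {set V} | independent A) #|A|.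

Definition degree (S : {set V}) : nat := #|[set e in edges H | S \subset e]|.

(* This is 0 if V has no l-element subset. *)
Definition max_degree (l : nat) : nat := \max_(S : {set V} | #|S| == l) degree S.

End Hypergraph.

(* The iterated logarithm, with negative values read as 0. *)
Definition loglog (R : realType) (x : R) : R := Num.max 0%R (ln (ln x)).

(* Main.v *)
Require Import Defs.
From mathcomp Require Import all_boot all_order all_fingroup all_algebra.
From mathcomp Require Import reals sequences exp.
From mathcomp Require Import zify ring lra.

(** Let [X = n / d] and [m = X ^ (1 / (k - 1))]. A random set of [m] vertices spans
    about as many edges as it has vertices, so deleting a vertex from each edge
    proves a bound of order [m]. The theorem asks for the additional factor
    [s = (c ln ln X) ^ (1 / (k - 1))].

    Take a larger random set, of about [M = m T] vertices, where [T] is a small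
    power of [ln X]; then [ln T] is of the order of [ln ln X], and the average
    degree in the sample is polynomial in [T]. The degree hypothesis bounds the
    degrees of all sets of at most [k - 2] vertices, and it implies that through
    [j] given sampled vertices, [2 <= j <= k - 2], one expects at most
    [poly(T) / M] sampled edges. Consequently a chain of polynomially many
    (in [T]) consecutively meeting edges that is met by a further edge in between
    [2] and [k - 2] vertices is so rare in the sample that all such
    configurations can be destroyed by deleting few vertices. Sets of [k - 1]
    vertices with too large a degree are few as well, and are destroyed in the
    same way, as are the vertices of too large a degree (lemma [sparsify]). The
    remaining hypergraph is [locally_sparse]: it looks like a tree, except that
    many edges may share the same [k - 1] vertices.

    On such a hypergraph run a random greedy process: every vertex receives a
    uniformly random round out of [T ^ 3], and in its round it is selected
    unless this could complete an edge. To decide whether [v] is blocked by an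
    edge [e], ask of each other vertex [u] of [e] whether it is selected in the
    variant that ignores the edges sharing at least two vertices with [e]; this
    only blocks more often. The outcomes for the vertices of [e] are then
    determined by disjoint sets of random rounds, the branches hanging off [e]
    (lemma [branch_disjoint]; here [k >= 4] is essential), hence are
    independent. A vertex is retired as soon as its probability of having been
    selected reaches [g = s / T]. So each vertex has the relevant status with
    probability [O(g)], the expected number of edges that block a given vertex
    is [O(T ^ (k - 1) g ^ (k - 1)) = O(s ^ (k - 1))], and round by round one finds
    that the vertex stays unblocked with probability at least
    [exp (- O(s ^ (k - 1))) >= T ^ (- 1 / 2)] when [s ^ (k - 1)] is a small multiple
    of [ln T]. A vertex that were never retired would be selected with about this
    probability, which is more than [g]; thus every vertex is selected with
    probability at least [g] (lemma [prob_chosen]). The expected size of the selected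
    set is at least [g M / 2 >= m s / 2]. *)

Set Implicit Arguments.
Unset Strict Implicit.
Unset Printing Implicit Defensive.

Import Order.TTheory GRing.Theory Num.Theory.
Local Open Scope ring_scope.

(** * Events in a uniformly random colouring *)

Section UniformColouring.
Variables (R : realType) (V : finType) (N : nat).
Local Notation Omega := {ffun V -> 'I_N}.

Definition Ex (f : Omega -> R) : R := (\sum_w f w) / #|{: Omega}|%:R.
Definition Pr (A : Omega -> bool) : R := Ex (fun w => (A w)%:R).

Definition depends_on (T : Type) (S : {set V}) (f : Omega -> T) :=
  forall w w' : Omega, (forall v, v \in S -> w v = w' v) -> f w = f w'.

Lemma Ex_le (f g : Omega -> R) : (forall w, f w <= g w) -> Ex f <= Ex g.
Proof.
move=> fg; rewrite /Ex ler_wpM2r ?invr_ge0 ?ler0n //.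
by apply: ler_sum => w _; exact: fg.
Qed.

Lemma Ex_sum (I : Type) (s : seq I) (P : pred I) (F : I -> Omega -> R) :
  Ex (fun w => \sum_(i <- s | P i) F i w) = \sum_(i <- s | P i) Ex (F i).
Proof. by rewrite /Ex exchange_big -mulr_suml. Qed.

Lemma ExD (f g : Omega -> R) : Ex (fun w => f w + g w) = Ex f + Ex g.
Proof. by rewrite /Ex big_split mulrDl. Qed.

Lemma ExB (f g : Omega -> R) : Ex (fun w => f w - g w) = Ex f - Ex g.
Proof. by rewrite /Ex sumrB mulrBl. Qed.

Lemma ExZ (a : R) (f : Omega -> R) : Ex (fun w => a * f w) = a * Ex f.
Proof. by rewrite /Ex -mulr_sumr mulrA. Qed.

Lemma eq_Pr (A B : Omega -> bool) : A =1 B -> Pr A = Pr B.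
Proof. by move=> AB; rewrite /Pr /Ex; under eq_bigr do rewrite AB. Qed.

Lemma Pr_ge0 (A : Omega -> bool) : 0 <= Pr A.
Proof. by rewrite /Pr /Ex divr_ge0 ?ler0n // sumr_ge0. Qed.

Lemma Pr_le (A B : Omega -> bool) : (forall w, A w -> B w) -> Pr A <= Pr B.
Proof. by move=> AB; apply: Ex_le => w; rewrite ler_nat; move: (AB w); do 2!case: (_ w) => // /(_ isT). Qed.

Lemma Pr_union (I : finType) (P : pred I) (A : Omega -> bool) (B : I -> Omega -> bool) :
  (forall w, A w -> exists2 i, P i & B i w) ->
  Pr A <= \sum_(i | P i) Pr (B i).
Proof.
move=> AB; rewrite -Ex_sum; apply: Ex_le => w.
case Aw: (A w); last by rewrite sumr_ge0.
have [i Pi Bi] := AB w Aw.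
by rewrite (bigD1 i) //= Bi lerDl sumr_ge0.
Qed.

Lemma Pr_union2 (A B C : Omega -> bool) :
  (forall w, A w -> B w || C w) -> Pr A <= Pr B + Pr C.
Proof.
move=> ABC; rewrite -ExD; apply: Ex_le => w.
by move: (ABC w); do 3!case: (_ w) => //=; rewrite ?addr0 ?add0r ?lerDl ?ler01 ?addr_ge0 // => /(_ isT).
Qed.

Lemma Pr_disjU (A B C : Omega -> bool) :
  (forall w, A w = B w || C w) -> (forall w, ~~ (B w && C w)) -> Pr A = Pr B + Pr C.
Proof.
move=> ABC BC; rewrite -ExD /Pr /Ex; congr (_ / _); apply: eq_bigr => w _.
by rewrite ABC; move: (BC w); do 2!case: (_ w); rewrite //= ?addr0 ?add0r.
Qed.

Hypothesis N_gt0 : (0 < N)%N.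

Lemma card_colourings_gt0 : (0 : R) < #|{: Omega}|%:R.
Proof. by rewrite ltr0n card_ffun card_ord expn_gt0 N_gt0. Qed.

Lemma Ex_cst (a : R) : Ex (fun=> a) = a.
Proof.
rewrite /Ex sumr_const -[a *+ _]mulr_natr mulfK //.
by rewrite gt_eqF // card_colourings_gt0.
Qed.

Lemma Ex_exists (f : Omega -> R) : exists w, Ex f <= f w.
Proof.
apply/existsP; rewrite -[[exists _, _]]negbK negb_exists; apply/negP => /forallP fE.
have w0 : Omega by apply: [ffun=> Ordinal N_gt0].
have : Ex (fun=> Ex f) - Ex f > 0.
  rewrite -ExB /Ex divr_gt0 ?card_colourings_gt0 //.
  rewrite (bigD1 w0) //= ltr_pwDl ?subr_gt0 ?real_ltNge ?num_real // ?fE // sumr_ge0 // => w _.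
  by rewrite subr_ge0 ltW // real_ltNge ?num_real.
by rewrite Ex_cst subrr ltxx.
Qed.

(** Exchanging the coordinates in [S] of two independent samples is an
    involution of pairs; it turns the product of two expectations into the
    expectation of the product. *)
Lemma Ex_indep (S : {set V}) (f g : Omega -> R) :
  depends_on S f -> depends_on (~: S) g ->
  Ex (fun w => f w * g w) = Ex f * Ex g.
Proof.
move=> fS gS; pose mix (w w' : Omega) : Omega := [ffun v => if v \in S then w v else w' v].
have sw : \sum_w \sum_w' f w * g w' = \sum_w \sum_(w' : Omega) f w * g w.
  rewrite !pair_bigA /= [RHS](reindex_inj (h := fun p => (mix p.1 p.2, mix p.2 p.1))) /=.
    apply: eq_bigr => -[w w'] _ /=; congr (_ * _).
      by apply: fS => v vS; rewrite ffunE vS.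
    by apply: gS => v; rewrite inE ffunE => /negbTE ->.
  have mixK : cancel (fun p : Omega * Omega => (mix p.1 p.2, mix p.2 p.1))
                     (fun p => (mix p.1 p.2, mix p.2 p.1)).
    move=> [w w']; congr (_, _) => /=; apply/ffunP => v; by rewrite !ffunE; case: (v \in S).
  exact: can_inj mixK.
have e : (\sum_w f w) * (\sum_w g w) = (\sum_w f w * g w) * #|{: Omega}|%:R.
  transitivity (\sum_w \sum_w' f w * g w').
    by rewrite mulr_suml; apply: eq_bigr => w _; rewrite mulr_sumr.
  by rewrite sw mulr_suml; apply: eq_bigr => w _; rewrite sumr_const mulr_natr.
have n0 : #|{: Omega}|%:R != 0 :> R by rewrite gt_eqF // card_colourings_gt0.
by rewrite /Ex mulrACA e mulrA mulfK.
Qed.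

Lemma Pr_indep (S : {set V}) (A B : Omega -> bool) :
  depends_on S A -> depends_on (~: S) B ->
  Pr (fun w => A w && B w) = Pr A * Pr B.
Proof.
move=> AS BS; rewrite /Pr -(Ex_indep (S := S)).
- by rewrite /Ex; congr (_ / _); apply: eq_bigr => w _; rewrite -natrM mulnb.
- by move=> w w' ww'; rewrite (AS w w').
- by move=> w w' ww'; rewrite (BS w w').
Qed.

Lemma Pr_indep_all (s : seq V) (T : V -> {set V}) (A : V -> Omega -> bool) :
  uniq s -> (forall v, v \in s -> depends_on (T v) (A v)) ->
  {in s &, forall u v, u != v -> [disjoint T u & T v]} ->
  Pr (fun w => all (A^~ w) s) = \prod_(v <- s) Pr (A v).
Proof.
elim: s => [|v s IHs] /=.
  by move=> _ _ _; rewrite big_nil /Pr /= Ex_cst.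
case/andP=> vs us dA dT; rewrite big_cons -IHs //; first last.
- by move=> x y xs ys; apply: dT; rewrite inE ?xs ?ys orbT.
- by move=> x xs; apply: dA; rewrite inE xs orbT.
apply: (Pr_indep (S := T v)); first by apply: dA; rewrite inE eqxx.
move=> w w' ww'; apply: eq_in_all => x xs.
apply: (dA x); first by rewrite inE xs orbT.
move=> y yx; apply: ww'; rewrite inE.
have /disjointFl -> // : [disjoint T v & T x].
apply: dT; rewrite ?inE ?eqxx ?xs ?orbT //.
by apply: contraNneq vs => ->.
Qed.

Lemma depends_onS (T : Type) (S S' : {set V}) (f : Omega -> T) :
  S \subset S' -> depends_on S f -> depends_on S' f.
Proof. by move=> /subsetP sub fS w w' ww'; apply: fS => v /sub; apply: ww'. Qed.

Lemma Pr_monochromatic (B : {set V}) (j : nat) : (j < N)%N ->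
  Pr (fun w => [forall v in B, val (w v) == j]) = (N%:R ^+ #|B|)^-1.
Proof.
move=> jN.
have P1 v : Pr (fun w => val (w v) == j) = N%:R^-1.
  have PE i : Pr (fun w => w v == i) = Pr (fun w => w v == Ordinal jN).
    rewrite /Pr /Ex; congr (_ / _).
    pose sw (w : Omega) : Omega := [ffun u => if u == v then tperm i (Ordinal jN) (w u) else w u].
    have swK : involutive sw.
      by move=> w; apply/ffunP => u; rewrite !ffunE; case: eqP => // _; rewrite tpermK.
    rewrite [RHS](reindex_inj (inv_inj swK)); apply: eq_bigr => w _.
    rewrite ffunE eqxx; congr (nat_of_bool _)%:R.
    by rewrite -{2}(tpermL i (Ordinal jN)) (inj_eq perm_inj).
  have : \sum_(i < N) Pr (fun w => w v == i) = 1.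
    rewrite -Ex_sum -[RHS](Ex_cst 1) /Ex; congr (_ / _); apply: eq_bigr => w _.
    by rewrite (bigD1 (w v)) //= eqxx big1 ?addr0 // => i; rewrite eq_sym => /negbTE ->.
  under eq_bigr do rewrite PE.
  have N0 : N%:R != 0 :> R by rewrite pnatr_eq0 -lt0n.
  rewrite sumr_const card_ord => h.
  by apply: (mulIf N0) => /=; rewrite [LHS]mulr_natr h mulVf.
rewrite -(eq_Pr (A := fun w => all (fun v => val (w v) == j) (enum B))).
  rewrite (Pr_indep_all (T := fun v => [set v])) ?enum_uniq //.
  - rewrite (eq_bigr (fun=> N%:R^-1)) => [|v _]; last exact: P1.
    by rewrite big_const_seq count_predT -cardE iter_mulr_1 exprVn.
  - by move=> v _ w w' ww'; rewrite ww' // inE.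
  - by move=> u v _ _ uv; rewrite disjoints1 inE.
move=> w; apply/allP/forall_inP => [h v vB|h v]; first by apply: h; rewrite mem_enum.
by rewrite mem_enum; apply: h.
Qed.

End UniformColouring.

(** * Locally sparse hypergraphs *)

Section LocallySparse.
Local Open Scope nat_scope.
Variables (V : finType) (E : {set {set V}}) (k : nat).

Definition meet : rel {set V} := fun a b => a :&: b != set0.

Definition verts (hs : seq {set V}) : {set V} := \bigcup_(h <- hs) h.

(** A substitute for large girth. Intersections of [k - 1] vertices have to be
    tolerated: a set of [k - 1] vertices may have large degree, and then random
    sampling leaves many edges that share it. *)
Definition locally_sparse (L : nat) : Prop :=
  forall hs e, sorted meet hs -> all (mem E) hs -> size hs <= L -> e \in E ->
  ~~ (2 <= #|e :&: verts hs| <= k - 2).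

Lemma meet_sym : symmetric meet.
Proof. by move=> a b; rewrite /meet setIC. Qed.

Lemma sorted_meet_rev hs : sorted meet (rev hs) = sorted meet hs.
Proof. by rewrite rev_sorted; apply: eq_sorted => a b; exact: meet_sym. Qed.

Lemma verts_cons h hs : verts (h :: hs) = h :|: verts hs.
Proof. by rewrite /verts big_cons. Qed.

Lemma mem_verts (h : {set V}) (hs : seq {set V}) v : h \in hs -> v \in h -> v \in verts hs.
Proof.
elim: hs => // a hs IHhs; rewrite inE verts_cons inE => /orP[/eqP -> -> //|/IHhs h1 /h1 ->].
exact: orbT.
Qed.

Lemma meetI u (a b : {set V}) : u \in a -> u \in b -> meet a b.
Proof. by move=> ua ub; apply/set0Pn; exists u; rewrite inE ua. Qed.

Lemma card_le1_eq (A : {set V}) u v : #|A| <= 1 -> u \in A -> v \in A -> u = v.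
Proof. by move/card_le1_eqP => h uA vA; apply: h. Qed.

Hypothesis uniformE : forall e, e \in E -> #|e| = k.
Hypothesis k_ge4 : 4 <= k.
Variable L : nat.
Hypothesis sparseE : locally_sparse L.

(** Adding one edge of the chain raises the intersection with [e] by at most one,
    from at most one to at most two, and two is a forbidden value because
    [2 <= k - 2]. *)
Lemma card_verts_le1 hs e :
  sorted meet hs -> all (mem E) hs -> size hs <= L -> e \in E ->
  (forall h, h \in hs -> #|e :&: h| <= 1) -> #|e :&: verts hs| <= 1.
Proof.
elim: hs => [|h hs IHhs] shs Ehs Lhs eE le1.
  by rewrite /verts big_nil setI0 cards0.
have := sparseE shs Ehs Lhs eE.
rewrite verts_cons setIUr.
have h1 : #|e :&: h| <= 1 by apply: le1; rewrite inE eqxx.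
have h2 : #|e :&: verts hs| <= 1.
  apply: IHhs => //; first by apply: path_sorted shs.
  - by case/andP: Ehs.
  - exact: ltnW.
  - by move=> g ghs; apply: le1; rewrite inE ghs orbT.
have := cardsU (e :&: h) (e :&: verts hs); lia.
Qed.

Hypothesis L_gt0 : 0 < L.

Lemma card_edgeI e f : e \in E -> f \in E -> 1 < #|e :&: f| -> k.-1 <= #|e :&: f|.
Proof.
move=> eE fE; have := sparseE (hs := [:: f]) (e := e).
rewrite /= fE /verts big_cons big_nil setU0 => /(_ isT isT L_gt0 eE); lia.
Qed.

(** Two edges with two common vertices have [k - 1] of them, and two subsets of
    [e] with [k - 1] elements share [k - 2 >= 2] vertices. Hence sharing at
    least two vertices is an equivalence relation on the edges. *)
Lemma card_edgeI_trans e f g : e \in E -> f \in E -> g \in E ->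
  1 < #|e :&: f| -> 1 < #|g :&: e| -> 1 < #|g :&: f|.
Proof.
move=> eE fE gE /(card_edgeI eE fE) ef /(card_edgeI gE eE) ge.
have := cardsUI (e :&: f) (g :&: e).
have : #|e :&: f :|: g :&: e| <= #|e|.
  by apply: subset_leq_card; rewrite subUset subsetIl subsetIr.
have : #|e :&: f :&: (g :&: e)| <= #|g :&: f|.
  apply: subset_leq_card; apply/subsetP => x; rewrite !inE.
  by case/andP=> /andP[_ ->] /andP[->].
rewrite (uniformE eE); lia.
Qed.

Lemma card_edgeI_le1 e f g : e \in E -> f \in E -> g \in E ->
  1 < #|e :&: f| -> (#|g :&: e| <= 1) = (#|g :&: f| <= 1).
Proof.
move=> eE fE gE ef; rewrite [LHS]leqNgt [RHS]leqNgt; congr (~~ _); apply/idP/idP.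
  exact: card_edgeI_trans.
by apply: card_edgeI_trans => //; rewrite setIC.
Qed.

(** Non-backtracking walks that leave [e] at [u]. Passing to an edge that shares
    two vertices with the previous one counts as backtracking, because such
    edges are not separated by local sparsity. *)
Fixpoint walk (u : V) (e : {set V}) (fs : seq {set V}) (w : V) : bool :=
  if fs is f :: fs' then
    [&& f \in E, u \in f, #|f :&: e| <= 1 & [exists u' in f :\ u, walk u' f fs' w]]
  else w == u.

Lemma walk_edges u e fs w : walk u e fs w -> all (mem E) fs.
Proof.
by elim: fs u e => //= f fs IH u e /and4P[-> _ _ /exists_inP[u' _ /IH]].
Qed.

Lemma walk_path u (e : {set V}) fs w : u \in e -> walk u e fs w -> path meet e fs.
Proof.
elim: fs u e => //= f fs IH u e ue /and4P[_ uf _ /exists_inP[u' ]].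
by rewrite inE => /andP[_ u'f] /(IH _ _ u'f) ->; rewrite (meetI ue uf).
Qed.

Lemma walk_end u (e : {set V}) fs w : u \in e -> walk u e fs w -> w \in last e fs.
Proof.
elim: fs u e => [u e ue /eqP -> //|f fs IH u e ue] /= /and4P[_ _ _ /exists_inP[u' ]].
by rewrite inE => /andP[_ u'f]; exact: IH.
Qed.

Lemma walk_start u e fs w : walk u e fs w -> u \in head [set u] fs.
Proof. by case: fs => [|f fs /and4P[]] //; rewrite inE. Qed.

(** If a walk came back to an edge [g] that shares two vertices with [e], then its
    second edge up to [g], followed by [e] itself, would be a chain meeting the
    first edge in the two distinct vertices [u] and [u'], although each edge
    of that chain meets it at most once. *)
Lemma walk_linear u (e : {set V}) fs w : e \in E -> u \in e -> walk u e fs w -> size fs <= L ->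
  {in fs, forall f, #|e :&: f| <= 1}.
Proof.
elim: fs u e => //= f fs IH u e eE ue /and4P[fE uf fe /exists_inP[u' ]].
rewrite !inE => /andP[u'u u'f] wfs sfs g; rewrite inE => /predU1P[-> |gfs].
  by rewrite setIC.
have {}IH := IH _ _ fE u'f wfs (ltnW sfs).
rewrite leqNgt; apply/negP => eg.
have Pfs := walk_path u'f wfs; have Efs := walk_edges wfs; have Sfs := walk_start wfs.
case/splitPr: gfs IH sfs Pfs Efs Sfs {wfs} => l1 l2 IH sfs Pfs Efs Sfs.
have le1 : #|f :&: verts (rcons (rcons l1 g) e)| <= 1.
  apply: card_verts_le1 => //.
  - apply: (@path_sorted _ _ f); rewrite rcons_path last_rcons.
    apply/andP; split; last by apply/set0Pn; move: (ltnW eg); rewrite card_gt0 setIC => /set0Pn.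
    by move: Pfs; rewrite cat_path rcons_path /= => /and3P[-> ->].
  - by move: Efs; rewrite !all_rcons all_cat /= eE => /and3P[-> ->].
  - move: sfs; rewrite !size_rcons size_cat /=; lia.
  - move=> h; rewrite mem_rcons inE => /predU1P[-> //|]; rewrite mem_rcons => hl.
    by apply: IH; rewrite mem_cat; move: hl; rewrite !inE => /orP[->|->]; rewrite ?orbT.
suff /(card_le1_eq le1) : u' \in f :&: verts (rcons (rcons l1 g) e).
  move/(_ u); rewrite inE uf (mem_verts _ ue) ?mem_rcons ?inE ?eqxx // => /(_ isT).
  by move/eqP; rewrite (negbTE u'u).
rewrite inE u'f; case: l1 {le1 IH sfs Pfs Efs} Sfs => [|a l1] /= Sfs.
  by apply: mem_verts Sfs; rewrite !inE eqxx.
by apply: mem_verts Sfs; rewrite inE eqxx.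
Qed.

(** Two walks with a common end, glued together there, form a chain that meets [e]
    in both [u] and [u']. *)
Lemma walks_disjoint (e : {set V}) u u' fs gs w : e \in E -> u \in e -> u' \in e -> u != u' ->
  walk u e fs w -> walk u' e gs w -> size fs + size gs <= L -> False.
Proof.
move=> eE ue u'e uu' wf wg sfg.
have : #|e :&: verts (fs ++ rev gs)| <= 1.
  apply: card_verts_le1 => //.
  - have := path_sorted (walk_path u'e wg); rewrite -sorted_meet_rev.
    have := walk_end ue wf; have := walk_end u'e wg; have := walk_path ue wf.
    case: fs {wf sfg} => [|f fs] //= /andP[_ fsP] wl wf.
    case/lastP: gs wl {wg} => [|gs g] /=; first by rewrite cats0.
    by rewrite rev_rcons last_rcons cat_path fsP /= => wg ->; rewrite (meetI wf wg).
  - by rewrite all_cat all_rev (walk_edges wf) (walk_edges wg).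
  - by rewrite size_cat size_rev.
  - have [sf sg] : size fs <= L /\ size gs <= L by lia.
    move=> h; rewrite mem_cat mem_rev => /orP[].
      exact: (walk_linear eE ue wf sf).
    exact: (walk_linear eE u'e wg sg).
move/card_le1_eqP => /(_ u u'); rewrite !inE ue u'e /=.
suff -> : u \in verts (fs ++ rev gs).
  suff -> : u' \in verts (fs ++ rev gs) by move=> /(_ isT isT) uE; rewrite uE eqxx in uu'.
  case: gs wg {sfg} => [/eqP wu'|g gs /walk_start /= u'g].
    case: fs wf => [/eqP wu|f fs /(walk_end ue)]; first by rewrite -wu -wu' eqxx in uu'.
    by rewrite cats0 wu' /= => u'l; apply: mem_verts u'l; apply: mem_last.
  by apply: mem_verts u'g; rewrite mem_cat mem_rev inE eqxx orbT.
case: fs wf {sfg} => [/eqP wu|f fs /walk_start /= uf].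
  case: gs wg => [/eqP wu'|g gs /(walk_end u'e)]; first by rewrite -wu -wu' eqxx in uu'.
  by rewrite wu /= => ul; apply: mem_verts ul; rewrite mem_rev mem_last.
by apply: mem_verts uf; rewrite inE eqxx.
Qed.

(** The coordinates that can influence the selection of [u] during [i] rounds when
    the edges sharing two vertices with [e] are ignored. *)
Fixpoint branch (i : nat) (u : V) (e : {set V}) : {set V} :=
  if i is j.+1 then
    u |: \bigcup_(f in E | (u \in f) && (#|f :&: e| <= 1))
           \bigcup_(u' in f :\ u) branch j u' f
  else [set u].

Lemma branch_root i u e : u \in branch i u e.
Proof. by case: i => [|i] /=; rewrite !inE eqxx. Qed.

Lemma branchS i u e : branch i u e \subset branch i.+1 u e.
Proof.
elim: i u e => [|i IH] u e; first by rewrite sub1set branch_root.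
rewrite [branch i.+2 _ _]/= [branch i.+1 _ _]/=; apply: setUS.
apply/bigcupsP => f fE; apply/bigcupsP => u' u'f.
apply: (subset_trans (IH u' f)).
by apply: subset_trans (bigcup_sup f fE); apply: (bigcup_sup u' u'f).
Qed.

Lemma branch_step i u e f u' : f \in E -> u \in f -> #|f :&: e| <= 1 -> u' \in f :\ u ->
  branch i u' f \subset branch i.+1 u e.
Proof.
move=> fE uf fe u'f /=; apply: subset_trans (subsetUr _ _).
apply: subset_trans (bigcup_sup f _); last by rewrite fE uf fe.
exact: (bigcup_sup u' u'f).
Qed.

Lemma branch_walk i u e w : w \in branch i u e -> exists2 fs, size fs <= i & walk u e fs w.
Proof.
elim: i u e => [|i IH] u e /=; first by rewrite inE => wu; exists [::].
rewrite inE => /orP[|/bigcupP[f /and3P[fE uf fe] /bigcupP[u' u'f /IH[fs sfs wfs]]]].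
  by rewrite inE => wu; exists [::].
exists (f :: fs) => //=; rewrite fE uf fe /=.
by apply/exists_inP; exists u'.
Qed.

Lemma branch_disjoint i (e : {set V}) u u' : e \in E -> u \in e -> u' \in e -> u != u' -> i.*2 <= L ->
  [disjoint branch i u e & branch i u' e].
Proof.
move=> eE ue u'e uu' iL; rewrite -setI_eq0; apply/eqP/setP => w; rewrite !inE.
apply/negP => /andP[/branch_walk[fs sfs wf] /branch_walk[gs sgs wg]].
by apply: (walks_disjoint eE ue u'e uu' wf wg); lia.
Qed.

End LocallySparse.
Arguments meet {V}.

(** * Blocking events and the independence of branches *)

Section Openness.
Variables (R : realType) (V : finType) (E : {set {set V}}) (k L N : nat).
Local Notation Omega := {ffun V -> 'I_N}.
Local Notation Prob := (@Pr R V N).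
Hypothesis N_gt0 : (0 < N)%N.
Hypothesis k_ge4 : (4 <= k)%N.
Hypothesis uniformE : forall e, e \in E -> #|e| = k.
Hypothesis sparseE : locally_sparse E k L.

(** Here [z w u f] stands for the status of [u] as seen from the edge [f]: an edge
    [f] blocks [v] when all its other vertices have that status. Only
    the edges that share at most one vertex with [e] count; for [e = set0] these
    are all the edges. *)
Definition unblocked (z : Omega -> V -> {set V} -> bool) (w : Omega) (v : V) (e : {set V}) : bool :=
  [forall f in E, (v \in f) && (#|f :&: e| <= 1)%N ==> [exists u in f :\ v, ~~ z w u f]].

Lemma unblockedP z w v e : reflect
  (forall f, f \in E -> v \in f -> (#|f :&: e| <= 1)%N -> exists2 u, u \in f :\ v & ~~ z w u f)
  (unblocked z w v e).
Proof.
apply: (iffP forall_inP) => h f fE.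
  by move=> vf fe; have := h f fE; rewrite vf fe => /exists_inP.
by apply/implyP => /andP[vf fe]; apply/exists_inP; apply: h.
Qed.

Lemma unblocked0 z w v e : unblocked z w v set0 -> unblocked z w v e.
Proof. by move=> /unblockedP h; apply/unblockedP => f fE vf _; apply: h; rewrite // setI0 cards0. Qed.

Section Status.
Variables (i : nat) (z : Omega -> V -> {set V} -> bool).
Hypothesis iL : (i.+1.*2 <= L)%N.
Hypothesis z_local : forall u e, depends_on (branch E i u e) (fun w => z w u e).
Hypothesis z_twin : forall w e f u, e \in E -> f \in E -> (1 < #|e :&: f|)%N ->
  u \in e -> u \in f -> z w u e = z w u f.

Lemma L_gt0 : (0 < L)%N. Proof. exact: leq_trans iL. Qed.

(** That [v] itself drops out of the support is what makes the round of [v]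
    independent of its being unblocked. *)
Lemma unblocked_local v e : depends_on (branch E i.+1 v e :\ v) (fun w => unblocked z w v e).
Proof.
move=> w w' ww'; rewrite /unblocked; apply: eq_forallb => f.
case fE: (f \in E) => //=; case vf: (v \in f) => //=.
case fe: (#|f :&: e| <= 1)%N => //=.
apply: eq_existsb => u; case uf: (u \in f :\ v) => //=; congr (~~ _).
apply: z_local => x xu; apply: ww'; rewrite inE; apply/andP; split; last first.
  by move: x xu; apply/subsetP; apply: branch_step.
rewrite inE; apply: contraTneq xu => ->.
move: uf; rewrite !inE => /andP[uv uf].
have iL' : (i.*2 <= L)%N by apply: leq_trans iL; rewrite leq_double.
have := branch_disjoint k_ge4 sparseE L_gt0 fE uf vf uv iL'.
by move=> /disjointFl ->; rewrite ?branch_root.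
Qed.

Lemma unblocked_local_branch v e : depends_on (branch E i.+1 v e) (fun w => unblocked z w v e).
Proof. by apply: depends_onS (@unblocked_local v e); exact: subsetDl. Qed.

Lemma unblocked_twin w e f v : e \in E -> f \in E -> (1 < #|e :&: f|)%N ->
  unblocked z w v e = unblocked z w v f.
Proof.
move=> eE fE ef; rewrite /unblocked; apply: eq_forallb => g.
case gE: (g \in E) => //=; congr (_ && _ ==> _).
exact: (card_edgeI_le1 uniformE k_ge4 sparseE L_gt0).
Qed.

Variable G : R.
Hypothesis z_le : forall e u, e \in E -> u \in e -> Prob (fun w => z w u e) <= G.
Hypothesis G_small : k%:R * G <= 1 / 2.

Lemma disjoint_setC (A B : {set V}) : [disjoint A & B] -> A \subset ~: B.
Proof. by rewrite subsets_disjoint setCK. Qed.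

(** An edge that shares two vertices with [e] can block [v] only if some vertex
    of [e] other than [v] has the status [z], and this status is independent of
    [unblocked z _ v e]. The edges ignored on behalf of [e] thus cost a factor two
    at most, however many of them there are. *)
Lemma Pr_unblocked_root e v : e \in E -> v \in e ->
  Prob (fun w => unblocked z w v e) <= 2 * Prob (fun w => unblocked z w v set0).
Proof.
move=> eE ve.
have h1 : Prob (fun w => unblocked z w v e) <= Prob (fun w => unblocked z w v set0) +
    Prob (fun w => [exists u in e :\ v, unblocked z w v e && z w u e]).
  apply: Pr_union2 => w oe; case o0: (unblocked z w v set0) => //=.
  move/negbT: o0; rewrite negb_forall_in => /exists_inP[f fE].
  rewrite setI0 cards0 negb_imply andbT => /andP[vf]; rewrite negb_exists_in => /forall_inP zf.
  have fe : (1 < #|e :&: f|)%N.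
    rewrite setIC ltnNge; apply/negP => fe; have [u uf] := unblockedP _ _ _ _ oe f fE vf fe.
    by have := zf u uf => /negPn ->.
  have /set0Pn[u] : (e :&: f) :\ v != set0.
    by rewrite -card_gt0; have := cardsD1 v (e :&: f); rewrite inE ve vf; lia.
  rewrite !inE => /and3P[uv ue uf].
  apply/exists_inP; exists u; rewrite ?inE ?uv //= oe (z_twin w eE fE fe ue uf).
  by have := zf u; rewrite !inE uv uf negbK => ->.
have h2 : Prob (fun w => [exists u in e :\ v, unblocked z w v e && z w u e]) <=
    k%:R * G * Prob (fun w => unblocked z w v e).
  apply: (le_trans (Pr_union R (P := [in e :\ v]) (B := fun u w => unblocked z w v e && z w u e) _)).
    by move=> w /exists_inP.
  apply: (@le_trans _ _ (\sum_(u in e :\ v) (G * Prob (fun w => unblocked z w v e)))).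
    apply: ler_sum => u; rewrite !inE => /andP[uv ue].
    rewrite (Pr_indep R N_gt0 (S := branch E i.+1 v e)) //.
    - by rewrite mulrC ler_wpM2r ?Pr_ge0 ?z_le.
    - exact: unblocked_local_branch.
    - apply: (depends_onS _ (@z_local u e)); apply: subset_trans (branchS _ _ _ _) _.
      apply: disjoint_setC.
      exact: (branch_disjoint k_ge4 sparseE L_gt0).
  have G0 : 0 <= G by apply: le_trans (z_le eE ve); exact: Pr_ge0.
  rewrite sumr_const -[_ *+ _]mulr_natl mulrA ler_wpM2r ?Pr_ge0 // ler_wpM2r // ler_nat.
  by rewrite -(uniformE eE) subset_leq_card // subsetDl.
have := le_trans h2 (ler_wpM2r (Pr_ge0 R (fun w => unblocked z w v e)) G_small).
by move: h1; lra.
Qed.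

(** When the statuses grow from [z] to [z'], a vertex becomes blocked through an
    edge [e] only if some [u] in [e] acquires its status now and the other
    [k - 2] vertices have it. These events and [unblocked z _ v e] live on
    disjoint branches, so their probabilities multiply. Independence inside one
    edge at a time is all that is needed: the blocking events of distinct edges
    may be correlated. *)
Lemma Pr_unblocked_step (z' : Omega -> V -> {set V} -> bool) (G' : R) v :
  (forall w u e, z w u e -> z' w u e) ->
  (forall u e, depends_on (branch E i.+1 u e) (fun w => z' w u e)) ->
  (forall e u, e \in E -> u \in e -> Prob (fun w => z' w u e) <= G') -> 
  Prob (fun w => unblocked z w v set0) *
    (1 - 2 * G' ^+ (k - 2) *
      \sum_(e in E | v \in e) \sum_(u in e :\ v) Prob (fun w => z' w u e && ~~ z w u e))
  <= Prob (fun w => unblocked z' w v set0).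
Proof.
move=> zz' z'_local z'_le.
rewrite mulrBr mulr1 lerBlDr.
pose B (eu : {set V} * V) (w : Omega) : bool :=
  all (fun x => if x == v then unblocked z w v eu.1
                else if x == eu.2 then z' w x eu.1 && ~~ z w x eu.1 else z' w x eu.1) (enum eu.1).
apply: (le_trans (Pr_union2 R (B := fun w => unblocked z' w v set0) (C := fun w =>
  [exists eu, [&& eu.1 \in E, v \in eu.1 & eu.2 \in eu.1 :\ v] && B eu w]) _)).
  move=> w o; case o': (unblocked z' w v set0) => //=.
  move/negbT: o'; rewrite negb_forall_in => /exists_inP[e eE].
  rewrite setI0 cards0 negb_imply andbT => /andP[ve]; rewrite negb_exists_in => /forall_inP z'e.
  have [|u ue zu] := unblockedP _ _ _ _ o e eE ve; first by rewrite setI0 cards0.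
  apply/existsP; exists (e, u); rewrite /= eE ve ue /=.
  apply/allP => x; rewrite mem_enum => xe /=; case: eqP => [_|/eqP xv]; first exact: unblocked0.
  have zx : z' w x e by have := z'e x; rewrite !inE xv xe negbK => ->.
  by case: eqP => [->|//]; rewrite zu andbT; have := z'e u ue; rewrite negbK.
rewrite lerD2l; apply: (le_trans (Pr_union R (B := B) _)) => [w /existsP[eu /andP[eu1 eu2]]|].
  exact: (ex_intro2 _ _ eu eu1 eu2).
rewrite mulrA mulr_sumr; set P0 := Prob _.
rewrite (eq_bigl (fun eu : {set V} * V => ((eu.1 \in E) && (v \in eu.1)) && (eu.2 \in eu.1 :\ v)));
  last by move=> eu; rewrite -andbA.
rewrite -(pair_big_dep (fun e => (e \in E) && (v \in e)) (fun e u => u \in e :\ v)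
  (fun e u => Prob (B (e, u)))) /=.
apply: ler_sum => e /andP[eE ve]; rewrite mulr_sumr; apply: ler_sum => u.
rewrite !inE => /andP[uv ue].
rewrite /B (Pr_indep_all R N_gt0 (T := fun x => branch E i.+1 x e)
  (A := fun x w => if x == v then unblocked z w v e
                else if x == u then z' w x e && ~~ z w x e else z' w x e)) ?enum_uniq //; first last.
- move=> x y; rewrite !mem_enum => xe ye xy.
  exact: (branch_disjoint k_ge4 sparseE L_gt0).
- move=> x _; case: eqP => [->|_]; first exact: unblocked_local_branch.
  case: eqP => [_|_]; last exact: z'_local.
  move=> w w' ww'; rewrite (z'_local _ _ _ _ ww'); congr (_ && ~~ _).
  by apply: z_local => y yx; apply: ww'; apply: (subsetP (branchS E i x e)).
rewrite big_enum /= (bigD1 v) //= (bigD1 u) /=; last by rewrite ue.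
rewrite eqxx (negbTE uv) eqxx.
have G'0 : 0 <= G' by apply: le_trans (z'_le _ _ eE ve); exact: Pr_ge0.
set p2 := Prob (fun w => z' w u e && ~~ z w u e).
have -> : P0 * (2 * G' ^+ (k - 2)) * p2 = (2 * P0) * (p2 * G' ^+ (k - 2)) by ring.
apply: ler_pM; first exact: Pr_ge0.
- by apply: mulr_ge0; [exact: Pr_ge0 | apply: prodr_ge0 => x _; exact: Pr_ge0].
- exact: Pr_unblocked_root.
rewrite ler_wpM2l ?Pr_ge0 //.
have -> : G' ^+ (k - 2) = \prod_(x | (x \in e) && (x != v) && (x != u)) G'.
  rewrite prodr_const; congr (_ ^+ _).
  have := cardsD1 v e; have := cardsD1 u (e :\ v).
  rewrite !inE ve ue uv (uniformE eE) => -> /= h.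
  rewrite h; have -> : (1 + (1 + #|e :\ v :\ u|) - 2 = #|e :\ v :\ u|)%N by lia.
  by apply: eq_card => x; rewrite !inE unfold_in /= andbC (andbC _ (x \in e)).
apply: ler_prod => x /andP[/andP[xe xv] xu].
by rewrite Pr_ge0 (negbTE xv) (negbTE xu) z'_le.
Qed.

End Status.
End Openness.

(** * The random selection process *)

Section Process.
Variables (R : realType) (V : finType) (E : {set {set V}}) (k L N : nat).
Local Notation Omega := {ffun V -> 'I_N}.
Local Notation Prob := (@Pr R V N).
Hypothesis N_gt0 : (0 < N)%N.
Hypothesis k_ge4 : (4 <= k)%N.
Hypothesis uniformE : forall e, e \in E -> #|e| = k.
Hypothesis sparseE : locally_sparse E k L.
Hypothesis NL : (N.+1.*2 <= L)%N.
Variable g : R.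

(** [selected j w u e]: the vertex [u] was selected in a round before [j] when the
    edges sharing two vertices with [e] are ignored. In its own round [u] is
    selected if its overall selection probability is still below [g] and no edge
    blocks it. The inner function is [candidate i], defined below: vertices of the
    same round count as selected, so that two of them cannot complete an edge
    together. The cap by [g] keeps selection probabilities bounded
    when degrees are irregular. *)
Fixpoint selected (j : nat) (w : Omega) (u : V) (e : {set V}) : bool :=
  if j is i.+1 then
    selected i w u e ||
    [&& val (w u) == i, Prob (fun w' => selected i w' u set0) < g &
        unblocked E (fun w v f => selected i w v f || (val (w v) == i)) w u e]
  else false.

Definition candidate (j : nat) (w : Omega) (u : V) (e : {set V}) : bool :=
  selected j w u e || (val (w u) == j).

(** This condition does not depend on the colouring: a vertex stops being
    eligible at a round fixed in advance. *)
Definition active (j : nat) (u : V) : bool := Prob (fun w => selected j w u set0) < g.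

Lemma selectedS j w u e :
  selected j.+1 w u e = selected j w u e || [&& val (w u) == j, active j u & unblocked E (candidate j) w u e].
Proof. by []. Qed.

Lemma selected_round j w u e : selected j w u e -> (val (w u) < j)%N.
Proof.
elim: j => // j IH; rewrite selectedS => /orP[/IH /ltnW //|/and3P[/eqP -> _ _]].
exact: ltnSn.
Qed.

Lemma selected_mono i j w u e : (i <= j)%N -> selected i w u e -> selected j w u e.
Proof. by elim: j i => [[]|j IH i] //; rewrite leq_eqVlt => /predU1P[->//|/IH h /h]; rewrite selectedS => ->. Qed.

(** Ignoring edges only makes selection easier, since activity is decided by the
    probability in which nothing is ignored. *)
Lemma selected0 j w u e : selected j w u set0 -> selected j w u e.
Proof.
elim: j => // j IH; rewrite !selectedS => /orP[/IH -> //|/and3P[-> -> /unblocked0 ->]].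
by rewrite orbT.
Qed.

Lemma selected_when j w u e : selected j w u e -> selected (val (w u)).+1 w u e /\ unblocked E (candidate (val (w u))) w u e.
Proof.
elim: j => // j IH; rewrite selectedS => /orP[/IH //|/and3P[/eqP wu a o]].
by rewrite wu selectedS wu eqxx a o orbT.
Qed.

Definition chosen (w : Omega) : {set V} := [set u | selected N w u set0].

(** In an edge inside the chosen set, a vertex with the latest round would have
    been blocked by the others. *)
Lemma chosen_independent w e : e \in E -> ~~ (e \subset chosen w).
Proof.
move=> eE; apply/negP => /subsetP es.
have /card_gt0P[v0 v0e] : (0 < #|e|)%N by rewrite (uniformE eE); lia.
have [v ve vmax] := @arg_maxnP _ v0 (mem e) (fun v => val (w v)) v0e.
have := es v ve; rewrite inE => /selected_when[_ /unblockedP/(_ e eE ve)].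
rewrite setI0 cards0 => /(_ isT)[u]; rewrite inE => /andP[_ ue] /negP; apply.
have := es u ue; rewrite inE => /(@selected0 _ _ _ e) su.
rewrite /candidate; have := vmax u ue; rewrite /= leq_eqVlt => /predU1P[->|lt]; first by rewrite eqxx orbT.
by have [/(selected_mono lt) -> _] := selected_when su.
Qed.


Lemma selected_twin j w e f u : e \in E -> f \in E -> (1 < #|e :&: f|)%N ->
  u \in e -> u \in f -> selected j w u e = selected j w u f.
Proof.
move=> eE fE ef ue uf; elim: j => // j IH; rewrite !selectedS IH; congr (_ || [&& _, _ & _]).
apply: (unblocked_twin k_ge4 uniformE sparseE (i := 0) (candidate j)) => //; lia.
Qed.

Lemma candidate_twin j w e f u : e \in E -> f \in E -> (1 < #|e :&: f|)%N ->
  u \in e -> u \in f -> candidate j w u e = candidate j w u f.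
Proof. by move=> *; rewrite /candidate; congr (_ || _); apply: selected_twin. Qed.

Lemma candidate_localW j u e :
  depends_on (branch E j u e) (fun w => selected j w u e) ->
  depends_on (branch E j u e) (fun w => candidate j w u e).
Proof. by move=> h w w' ww'; rewrite /candidate (h w w') // ww' ?branch_root. Qed.

Lemma selected_local j : (j <= N)%N -> forall u e, depends_on (branch E j u e) (fun w => selected j w u e).
Proof.
elim: j => [//|j IH jN] u e w w' ww'; rewrite !selectedS.
have {}IH := IH (ltnW jN).
rewrite (IH u e w w'); last by move=> v vb; apply: ww'; apply: (subsetP (branchS E j u e)).
rewrite ww' ?branch_root //; congr (_ || [&& _, _ & _]).
have jL : (j.+1.*2 <= L)%N by lia.
apply: (unblocked_local_branch k_ge4 sparseE jL) ww' => x f.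
exact: candidate_localW.
Qed.

Lemma candidate_local j : (j <= N)%N -> forall u e, depends_on (branch E j u e) (fun w => candidate j w u e).
Proof. by move=> jN u e; apply: candidate_localW; exact: selected_local. Qed.

Local Notation q := (N%:R^-1 : R).
Local Notation G := (2 * (g + q)).
Local Notation prob_selected j u e := (Prob (fun w => selected j w u e)).
Local Notation gain j u e := (Prob (fun w => selected j.+1 w u e && ~~ selected j w u e)).

Lemma q_gt0 : 0 < q. Proof. by rewrite invr_gt0 ltr0n. Qed.

Lemma Pr_round j u : (j < N)%N -> Prob (fun w => val (w u) == j) = q.
Proof.
move=> jN; have := Pr_monochromatic R N_gt0 [set u] jN; rewrite cards1 expr1 => <-.
apply: eq_Pr => w; apply/idP/forall_inP => [h v|]; first by rewrite inE => /eqP ->.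
by apply; rewrite inE.
Qed.

Lemma prob_selectedS j u e : prob_selected j.+1 u e = prob_selected j u e + gain j u e.
Proof.
apply: Pr_disjU => w; last by case: (selected j w u e); rewrite ?andbF.
by rewrite selectedS; case: (selected j w u e) => //=; rewrite andbT.
Qed.

Lemma prob_selected_sum j u e : prob_selected j u e = \sum_(i < j) gain i u e.
Proof.
elim: j => [|j IH]; last by rewrite prob_selectedS IH big_ord_recr.
by rewrite big_ord0 /Pr /Ex big1 ?mul0r.
Qed.

(** The round of [u] is independent of the event that [u] is unblocked. *)
Lemma gainE j u e : (j < N)%N -> e = set0 \/ e \in E /\ u \in e ->
  gain j u e = if active j u then q * Prob (fun w => unblocked E (candidate j) w u e) else 0.
Proof.
move=> jN ue.
have -> : gain j u e = Prob (fun w => [&& val (w u) == j, active j u & unblocked E (candidate j) w u e]).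
  apply: eq_Pr => w; rewrite selectedS.
  case s: (selected j w u e) => /=; last by rewrite andbT.
  by have := selected_round s; case: eqP => //= ->; rewrite ltnn.
case: (active j u); last by rewrite /Pr /Ex big1 ?mul0r // => w _; rewrite andbF.
rewrite -(Pr_round u jN) -(Pr_indep R N_gt0 (S := [set u])) //.
  by move=> w w' ww'; rewrite ww' // inE.
have jL : (j.+1.*2 <= L)%N by lia.
apply: depends_onS (unblocked_local k_ge4 sparseE jL (candidate_local (ltnW jN)) (v := u) (e := e)).
by apply/subsetP => x; rewrite !inE => /andP[].
Qed.

Lemma gain_le j u e : (j < N)%N -> gain j u e <= q.
Proof.
move=> jN; rewrite -(Pr_round u jN); apply: Pr_le => w.
by rewrite selectedS; case: (selected j w u e) => //=; rewrite andbT => /and3P[].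
Qed.

(** The cap [g] can be exceeded only by the gain of one round. *)
Lemma prob_selected_root_le j u : 0 <= g -> (j <= N)%N -> prob_selected j u set0 <= g + q.
Proof.
move=> g0; elim: j => [_|j IH jN]; first by rewrite /Pr /Ex big1 ?mul0r // addr_ge0 // ltW // q_gt0.
rewrite prob_selectedS; case a: (active j u).
  by rewrite lerD ?gain_le // ltW.
by rewrite (gainE jN) ?a ?addr0 ?IH //; [exact: ltnW | left].
Qed.

Hypothesis g_ge0 : 0 <= g.
Hypothesis G_small : k%:R * (G + q) <= 1 / 2.

Lemma prob_candidate_le j u e b : (j < N)%N -> prob_selected j u e <= b -> Prob (fun w => candidate j w u e) <= b + q.
Proof.
move=> jN h; apply: le_trans (lerD h (lexx _)); rewrite -(Pr_round u jN).
exact: Pr_union2.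
Qed.

(** The activity conditions on both sides are the same, so that the gains of each
    round can be compared by [Pr_unblocked_root]. *)
Lemma prob_selected_le2 j u e : (j <= N)%N -> e \in E -> u \in e ->
  prob_selected j u e <= 2 * prob_selected j u set0.
Proof.
elim: j u e => [|j IH] u e jN eE ue; first by rewrite /Pr /Ex !big1 ?mul0r ?mulr0.
have {}IH := IH _ _ (ltnW jN); rewrite !prob_selectedS mulrDr lerD ?IH //.
rewrite !gainE //; [|by left|by right]; case: (active j u); last by rewrite mulr0.
rewrite [leRHS]mulrCA ler_wpM2l //; first exact: ltW q_gt0.
have jL : (j.+1.*2 <= L)%N by lia.
apply: (Pr_unblocked_root N_gt0 k_ge4 uniformE sparseE jL (candidate_local (ltnW jN)) (@candidate_twin j) _ G_small) => //.
move=> f v fE vf; apply: prob_candidate_le => //; apply: le_trans (IH _ _ fE vf) _.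
by rewrite ler_wpM2l // prob_selected_root_le // ltnW.
Qed.

Lemma prob_selected_le j u e : (j <= N)%N -> e \in E -> u \in e -> prob_selected j u e <= G.
Proof.
move=> jN eE ue; apply: le_trans (prob_selected_le2 jN eE ue) _.
by rewrite ler_wpM2l // prob_selected_root_le.
Qed.

Variable D : R.
Hypothesis degE : forall v, #|[set e in E | v \in e]|%:R <= D.
Hypothesis step_small : 2 * (G + q) ^+ (k - 2) * (D * k%:R * q) <= 1 / 2.

Lemma G_ge0 : 0 <= G.
Proof. by rewrite mulr_ge0 // addr_ge0 // ltW // q_gt0. Qed.

Lemma sum_pairs_le v (F : {set V} -> V -> R) b : 0 <= b ->
  (forall e u, e \in E -> u \in e -> F e u <= b) ->
  \sum_(e in E | v \in e) \sum_(u in e :\ v) F e u <= D * k%:R * b.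
Proof.
move=> b0 Fb; apply: (@le_trans _ _ (\sum_(e in E | v \in e) (k%:R * b))).
  apply: ler_sum => e /andP[eE ve].
  apply: (@le_trans _ _ (\sum_(u in e :\ v) b)).
    by apply: ler_sum => u; rewrite inE => /andP[_ ue]; apply: Fb.
  rewrite sumr_const -[_ *+ _]mulr_natl ler_wpM2r // ler_nat -(uniformE eE).
  by rewrite subset_leq_card // subsetDl.
rewrite sumr_const -[_ *+ _]mulr_natl -mulrA ler_wpM2r ?mulr_ge0 //.
by apply: le_trans (degE v); rewrite ler_nat cardsE.
Qed.

(** Up to the factor [2 * G ^+ (k - 2)], a bound for the relative loss of the
    probability that [v] is unblocked during round [j]. *)
Definition loss j v : R := \sum_(e in E | v \in e) \sum_(u in e :\ v) gain j u e.

Lemma loss_ge0 j v : 0 <= loss j v.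
Proof. by apply: sumr_ge0 => e _; apply: sumr_ge0 => u _; exact: Pr_ge0. Qed.

Lemma prob_unblocked_selected j v : (j < N)%N ->
  Prob (fun w => unblocked E (selected j) w v set0) * (1 - 2 * G ^+ (k - 2) * loss j v) <=
  Prob (fun w => unblocked E (selected j.+1) w v set0).
Proof.
move=> jN; have jL : (j.+1.*2 <= L)%N by lia.
have Gsm : k%:R * G <= 1 / 2.
  by apply: le_trans G_small; rewrite ler_wpM2l // lerDl ltW // q_gt0.
apply: (Pr_unblocked_step N_gt0 k_ge4 uniformE sparseE jL (selected_local (ltnW jN)) (@selected_twin j) _ Gsm) => //.
- by move=> e u eE ue; apply: prob_selected_le => //; exact: ltnW.
- by move=> w u e; apply: selected_mono.
- exact: (selected_local jN).
- by move=> e u eE ue; exact: prob_selected_le.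
Qed.

(** Counting the vertices of the current round as selected costs at most half of
    the probability, as a single round is short. *)
Lemma prob_unblocked_candidate j v : (j < N)%N ->
  Prob (fun w => unblocked E (selected j) w v set0) / 2 <= Prob (fun w => unblocked E (candidate j) w v set0).
Proof.
move=> jN; have jL : (j.+1.*2 <= L)%N by lia.
have Gsm : k%:R * G <= 1 / 2.
  by apply: le_trans G_small; rewrite ler_wpM2l // lerDl ltW // q_gt0.
have zle e u : e \in E -> u \in e -> prob_selected j u e <= G by exact: prob_selected_le (ltnW jN).
have cle e u : e \in E -> u \in e -> Prob (fun w => candidate j w u e) <= G + q.
  by move=> eE ue; apply: prob_candidate_le => //; exact: zle.
have sc w u e : selected j w u e -> candidate j w u e by rewrite /candidate => ->.
have loc u e : depends_on (branch E j.+1 u e) (fun w => candidate j w u e).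
  by apply: depends_onS (candidate_local (ltnW jN) (u := u) (e := e)); exact: branchS.
apply: le_trans (Pr_unblocked_step N_gt0 k_ge4 uniformE sparseE jL (selected_local (ltnW jN))
  (@selected_twin j) zle Gsm v sc loc cle).
rewrite ler_wpM2l ?Pr_ge0 // lerBrDr addrC -lerBrDr.
apply: (@le_trans _ _ (1 / 2)); last by lra.
apply: le_trans step_small; rewrite ler_wpM2l //.
  by rewrite mulr_ge0 // exprn_ge0 // addr_ge0 ?G_ge0 // ltW // q_gt0.
apply: sum_pairs_le => [|e u eE ue]; first exact: ltW q_gt0.
rewrite -(Pr_round u jN); apply: Pr_le => w.
by rewrite /candidate; case: (selected j w u e) => //=; rewrite andbT.
Qed.

(** Over all rounds the gains of one vertex telescope to its selection
    probability. *)
Lemma sum_loss_le j v : (j <= N)%N -> \sum_(i < j) loss i v <= D * k%:R * G.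
Proof.
move=> jN; rewrite /loss exchange_big /=; under eq_bigr do rewrite exchange_big /=.
apply: sum_pairs_le; first exact: G_ge0.
by move=> e u eE ue; rewrite -prob_selected_sum prob_selected_le.
Qed.

Lemma expR_le_1B (x : R) : 0 <= x -> x <= 1 / 2 -> expR (- (2 * x)) <= 1 - x.
Proof.
move=> x0 x1; rewrite expRN invf_ple ?posrE ?expR_gt0 //; last by lra.
apply: le_trans (expR_ge1Dx _); rewrite -[leLHS]mul1r ler_pdivrMr; last by lra.
nra.
Qed.

Lemma prob_unblocked_ge j v : (j <= N)%N ->
  expR (- (4 * G ^+ (k - 2) * \sum_(i < j) loss i v)) <= Prob (fun w => unblocked E (selected j) w v set0).
Proof.
elim: j => [_|j IH jN].
  rewrite big_ord0 mulr0 oppr0 expR0 -[leLHS](Ex_cst V N_gt0); apply: Ex_le => w.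
  rewrite (_ : unblocked _ _ _ _ _) //; apply/unblockedP => f fE vf _.
  have : (0 < #|f :\ v|)%N by have := cardsD1 v f; rewrite vf (uniformE fE); lia.
  by move/card_gt0P => [u uf]; exists u.
apply: le_trans (prob_unblocked_selected v jN).
rewrite big_ord_recr /= mulrDr opprD expRD.
have -> : - (4 * G ^+ (k - 2) * loss j v) = - (2 * (2 * G ^+ (k - 2) * loss j v)) by ring.
apply: ler_pM; rewrite ?expR_ge0 ?IH 1?ltnW //.
apply: expR_le_1B.
  by rewrite !mulr_ge0 ?loss_ge0 ?exprn_ge0 ?G_ge0.
apply: le_trans step_small; apply: ler_pM; rewrite ?mulr_ge0 ?exprn_ge0 ?G_ge0 ?loss_ge0 //.
  by rewrite ler_wpM2l // lerXn2r ?nnegrE ?addr_ge0 ?G_ge0 ?lerDl // ltW // q_gt0.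
by apply: sum_pairs_le => [|e u eE ue]; [exact: ltW q_gt0 | exact: gain_le].
Qed.

Hypothesis g_small : g <= expR (- (4 * G ^+ (k - 2) * (D * k%:R * G))) / 2.

(** Either the selection probability of [v] reaches the cap [g] at some round, or
    [v] is active throughout; then its gain in each of the [N] rounds is at least
    [1 / N] times half the probability of staying unblocked to the end. *)
Lemma prob_chosen v : g <= Prob (fun w => v \in chosen w).
Proof.
rewrite (eq_Pr R (B := fun w => selected N w v set0)) => [|w]; last by rewrite inE.
case: (leP g (prob_selected N v set0)) => // lt; exfalso; move: (lt).
apply/negP; rewrite -leNgt prob_selected_sum; apply: le_trans g_small _.
apply: (@le_trans _ _ (\sum_(i < N) (q * (expR (- (4 * G ^+ (k - 2) * (D * k%:R * G))) / 2)))).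
  by rewrite sumr_const card_ord -mulrnAl -[q *+ N]mulr_natl mulfV ?mul1r // pnatr_eq0 -lt0n.
apply: ler_sum => i _; have iN := ltn_ord i.
rewrite gainE //; last by left.
have -> : active i v.
  apply: le_lt_trans lt; apply: Pr_le => w; apply: selected_mono; exact: ltnW.
rewrite ler_wpM2l //; first exact: ltW q_gt0.
apply: le_trans (prob_unblocked_candidate v iN); rewrite ler_wpM2r ?invr_ge0 //.
apply: le_trans (prob_unblocked_ge v (ltnW iN)); rewrite ler_expR lerN2 ler_wpM2l //.
  by rewrite mulr_ge0 // exprn_ge0 // G_ge0.
by apply: sum_loss_le; exact: ltnW.
Qed.

Lemma exists_independent (U : {set V}) : exists I : {set V},
  [/\ I \subset U, forall e, e \in E -> ~~ (e \subset I) & g * #|U|%:R <= #|I|%:R].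
Proof.
have [w] := Ex_exists N_gt0 (fun w => \sum_(v in U) (v \in chosen w)%:R : R).
rewrite Ex_sum => h; exists (U :&: chosen w); split; first exact: subsetIl.
  move=> e eE; apply: contra (chosen_independent w eE) => /subset_trans; apply.
  exact: subsetIr.
apply: le_trans (le_trans _ h) _.
  rewrite mulrC mulr_natl -sumr_const; apply: ler_sum => v _; exact: prob_chosen.
rewrite -natr_sum ler_nat -sum1_card big_mkcond [leqRHS]big_mkcond.
by apply: leq_sum => v _; rewrite in_setI; case: (v \in U) => //=; case: (_ \in _).
Qed.

End Process.

(** * Expected numbers of short configurations *)

Section Weights.
Variables (R : realType) (V : finType) (k : nat) (p : R).
Hypothesis p_ge0 : 0 <= p.

Definition deg (H : {set {set V}}) (A : {set V}) : nat := #|[set e in H | A \subset e]|.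

(** The weight of an edge is the probability that its vertices outside [W] are
    sampled. Grouping the edges by their trace [A] on [W], each of the at most
    [2 ^ #|W|] traces contributes at most [b]. *)
Lemma sum_extensions_le (H : {set {set V}}) (P : pred nat) (b : R) (W : {set V}) :
  (forall e, e \in H -> #|e| = k) ->
  0 <= b -> (forall A : {set V}, P #|A| -> (deg H A)%:R * p ^+ (k - #|A|) <= b) ->
  \sum_(e in H | P #|e :&: W|) p ^+ #|e :\: W| <= 2 ^+ #|W| * b.
Proof.
move=> uH b0 Hb.
rewrite (partition_big (fun e => e :&: W) (fun A => (A \in powerset W) && P #|A|)) /=; last first.
  by move=> e /andP[_ ->]; rewrite inE subsetIr.
apply: (@le_trans _ _ (\sum_(A in powerset W | P #|A|) b)).
  apply: ler_sum => A /andP[AW PA]; apply: le_trans (Hb A PA).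
  apply: (@le_trans _ _ (\sum_(e in [set e in H | A \subset e]) p ^+ (k - #|A|))).
    rewrite [leRHS](bigID (fun e => P #|e :&: W| && (e :&: W == A))) /=.
    rewrite -[leLHS]addr0 lerD //; last by apply: sumr_ge0 => e _; rewrite exprn_ge0.
    rewrite le_eqVlt; apply/orP; left; apply/eqP; apply: eq_big => e.
      rewrite inE -!andbA; case eH: (e \in H) => //=; case: (P _); rewrite /= ?andbF //.
      by case: eqP => [<-|]; rewrite ?andbF // subsetIl.
    move=> /andP[/andP[eH _] /eqP eA]; congr (_ ^+ _).
    by rewrite cardsD eA (uH _ eH).
  by rewrite sumr_const -[_ *+ _]mulr_natl /deg.
rewrite sumr_const -[_ *+ _]mulr_natl.
rewrite ler_wpM2r // -natrX ler_nat -card_powerset.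
by apply: subset_leq_card; apply/subsetP => B /andP[].
Qed.

Definition linked (h : {set V}) (hs : seq {set V}) : bool :=
  if hs is g :: _ then meet h g else true.

Fixpoint chains (H : {set {set V}}) (l : nat) : seq (seq {set V}) :=
  if l is i.+1 then
    [seq h :: hs | hs <- chains H i, h <- [seq h <- enum H | linked h hs]]
  else [:: [::]].

Lemma chainsP (H : {set {set V}}) l hs :
  reflect [/\ size hs = l, sorted meet hs & all (mem H) hs] (hs \in chains H l).
Proof.
elim: l hs => [|l IH] hs /=.
  by rewrite inE; apply: (iffP eqP) => [-> //|[/size0nil]].
apply: (iffP allpairsPdep) => [[gs [h [/IH[<- sgs Hgs]]]]|[]].
  rewrite mem_filter mem_enum => /andP[hgs hH ->] /=; split=> //; last by rewrite hH.
  by case: gs sgs hgs {Hgs} => //= g gs -> ->.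
case: hs => // h hs [sl] shs /= /andP[hH Hhs]; exists hs, h; split=> //.
  by apply/IH; split=> //; apply: path_sorted shs.
by rewrite mem_filter mem_enum hH andbT; case: hs shs {sl Hhs} => //= g hs /andP[].
Qed.

Lemma cardsUD (A B : {set V}) : #|A :|: B| = (#|B| + #|A :\: B|)%N.
Proof. by rewrite cardsU cardsD; have := subset_leq_card (subsetIl A B); lia. Qed.

Lemma card_verts (H : {set {set V}}) l (hs : seq {set V}) : (forall e, e \in H -> #|e| = k) -> hs \in chains H l ->
  (#|verts hs| <= k * l)%N.
Proof.
move=> uH /chainsP[<- _]; elim: hs => [|h hs IH] /=; first by rewrite /verts big_nil cards0.
case/andP=> hH /IH {}IH; rewrite verts_cons cardsU (uH _ hH) mulnS.
by apply: leq_trans (leq_subr _ _) _; rewrite leq_add2l.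
Qed.

Lemma big_chainsS (H : {set {set V}}) l (F : seq {set V} -> R) :
  \sum_(hs <- chains H l.+1) F hs =
  \sum_(hs <- chains H l) \sum_(h in H | linked h hs) F (h :: hs).
Proof.
rewrite /= big_allpairs_dep; apply: eq_bigr => hs _.
by rewrite big_filter big_enum_cond.
Qed.

(** Prolonging a chain by one edge multiplies the expected number of sampled chains
    by at most [2 ^+ (k * L) * b], since the new edge meets the old ones. *)
Lemma sum_chains_le (H : {set {set V}}) (L l : nat) (a b : R) :
  (forall e, e \in H -> #|e| = k) -> 0 <= a -> 0 <= b -> 
  #|H|%:R * p ^+ k <= b * a ->
  (forall A : {set V}, (0 < #|A|)%N -> (deg H A)%:R * p ^+ (k - #|A|) <= b) ->
  (l < L)%N ->
  \sum_(hs <- chains H l.+1) p ^+ #|verts hs| <= b * a * (2 ^+ (k * L) * b) ^+ l.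
Proof.
move=> uH a0 b0 H1 Hb; elim: l => [_|l IH lL].
  rewrite big_chainsS /= big_seq1 expr0 mulr1; apply: le_trans H1.
  rewrite mulr_natl -sumr_const le_eqVlt; apply/orP; left; apply/eqP.
  apply: eq_big => [h|h /andP[hH _]]; first by rewrite andbT.
  by rewrite verts_cons /verts big_nil setU0 (uH _ hH).
rewrite big_chainsS.
apply: (@le_trans _ _ (\sum_(hs <- chains H l.+1) p ^+ #|verts hs| * (2 ^+ (k * L) * b))).
  rewrite big_seq [leRHS]big_seq; apply: ler_sum => hs hsC.
  have -> : \sum_(h in H | linked h hs) p ^+ #|verts (h :: hs)| =
     p ^+ #|verts hs| * \sum_(h in H | linked h hs) p ^+ #|h :\: verts hs|.
    by rewrite mulr_sumr; apply: eq_bigr => h _; rewrite verts_cons cardsUD exprD.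
  rewrite ler_wpM2l ?exprn_ge0 //.
  apply: (@le_trans _ _ (2 ^+ #|verts hs| * b)).
    apply: le_trans (@sum_extensions_le H (ltn 0) b (verts hs) uH b0 Hb).
    rewrite [leRHS](bigID (fun h => linked h hs)) /=.
    rewrite -[leLHS]addr0 lerD //; last by apply: sumr_ge0 => e _; rewrite exprn_ge0.
    rewrite le_eqVlt; apply/orP; left; apply/eqP; apply: eq_bigl => h.
    rewrite -andbA; congr (_ && _); case: hs hsC => [|g gs _ /=]; first by move=> /chainsP[].
    case hg: (meet h g); rewrite ?andbF //= andbT; apply/esym; rewrite card_gt0.
    move: hg => /set0Pn[x]; rewrite inE => /andP[xh xg]; apply/set0Pn; exists x.
    by rewrite inE xh verts_cons inE xg.
  rewrite ler_wpM2r // ler_weXn2l ?ler1n //.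
  by apply: leq_trans (card_verts uH hsC) _; rewrite leq_mul2l (ltnW lL) orbT.
by rewrite -mulr_suml exprSr [leRHS]mulrA ler_wpM2r ?mulr_ge0 ?exprn_ge0 // IH // ltnW.
Qed.

(** The vertex sets of the configurations excluded by [locally_sparse]. *)
Definition violations (H : {set {set V}}) (l : nat) : seq {set V} :=
  [seq e :|: verts hs | hs <- chains H l,
     e <- [seq e <- enum H | (2 <= #|e :&: verts hs| <= k - 2)%N]].

(** The closing edge meets the chain in at least two vertices, which makes it rarer
    by the factor [a] than an ordinary prolongation; this factor cancels the
    choice of the starting edge, and the bound no longer grows with [a]. *)
Lemma sum_violations_le (H : {set {set V}}) (L l : nat) (a b : R) :
  (forall e, e \in H -> #|e| = k) -> 0 < a -> 0 <= b -> 
  #|H|%:R * p ^+ k <= b * a ->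
  (forall A : {set V}, (0 < #|A|)%N -> (deg H A)%:R * p ^+ (k - #|A|) <= b) ->
  (forall A : {set V}, (2 <= #|A| <= k - 2)%N -> (deg H A)%:R * p ^+ (k - #|A|) <= b / a) ->
  (l < L)%N ->
  \sum_(W <- violations H l.+1) p ^+ #|W| <= b * (2 ^+ (k * L) * b) ^+ l.+1.
Proof.
move=> uH a0 b0 H1 Hb H2 lL; rewrite big_allpairs_dep.
apply: (@le_trans _ _ (\sum_(hs <- chains H l.+1) p ^+ #|verts hs| * (2 ^+ (k * L) * (b / a)))).
  rewrite big_seq [leRHS]big_seq; apply: ler_sum => hs hsC.
  rewrite big_filter big_enum_cond /=.
  have -> : \sum_(e in H | (2 <= #|e :&: verts hs| <= k - 2)%N) p ^+ #|e :|: verts hs| =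
     p ^+ #|verts hs| * \sum_(e in H | (2 <= #|e :&: verts hs| <= k - 2)%N) p ^+ #|e :\: verts hs|.
    by rewrite mulr_sumr; apply: eq_bigr => h _; rewrite cardsUD exprD.
  have ba0 : 0 <= b / a by rewrite divr_ge0 // ltW.
  rewrite ler_wpM2l ?exprn_ge0 //.
  apply: (le_trans (@sum_extensions_le H (fun j => 2 <= j <= k - 2)%N (b / a) (verts hs) uH ba0 H2)).
  rewrite ler_wpM2r // ler_weXn2l ?ler1n //.
  by apply: leq_trans (card_verts uH hsC) _; rewrite leq_mul2l lL orbT.
rewrite -mulr_suml exprSr.
have a0' := ltW a0.
apply: (le_trans (ler_wpM2r _ (sum_chains_le uH a0' b0 H1 Hb lL))).
  by rewrite mulr_ge0 ?exprn_ge0 ?divr_ge0.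
set Q := (_ ^+ l); set c := 2 ^+ _; rewrite le_eqVlt; apply/orP; left; apply/eqP.
by field; rewrite gt_eqF.
Qed.

Lemma chain_violation (H : {set {set V}}) (L : nat) (U : {set V}) :
  (forall W l, (l < L)%N -> W \in violations H l.+1 -> ~~ (W \subset U)) ->
  locally_sparse [set e in H | e \subset U] k L.
Proof.
move=> noV hs e shs Ehs Lhs; rewrite inE => /andP[eH eU]; apply/negP => bad.
have hs0 : (0 < size hs)%N.
  by case: hs {shs Ehs Lhs} bad => //; rewrite /verts big_nil setI0 cards0.
have sU : verts hs \subset U.
  elim: hs Ehs {shs Lhs bad hs0} => [_|h hs IH /= /andP[]]; first by rewrite /verts big_nil sub0set.
  by rewrite inE => /andP[_ hU] /IH sU; rewrite verts_cons subUset hU.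
have inV : e :|: verts hs \in violations H (size hs).-1.+1.
  apply: allpairs_f_dep; last by rewrite mem_filter mem_enum bad.
  apply/chainsP; split; rewrite ?prednK //; apply: sub_all Ehs => g.
  by rewrite /= inE => /andP[].
have := noV _ _ _ inV; rewrite prednK // => /(_ Lhs).
by rewrite subUset eU sU.
Qed.

End Weights.

Section Hitting.
Variable V : finType.

(** Delete one vertex from each member of [s] that lies in [U]. *)
Lemma hitting_set (s : seq {set V}) (U : {set V}) : all (fun B : {set V} => B != set0) s ->
  exists2 D : {set V}, (#|D| <= count (fun B : {set V} => B \subset U) s)%N &
    forall B : {set V}, B \in s -> ~~ (B \subset U :\: D).
Proof.
elim: s => [_|B s IH /= /andP[/set0Pn[x xB] /IH[D cD hD]]]; first by exists set0; rewrite ?cards0.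
case BU: (B \subset U).
  exists (x |: D); first by rewrite cardsU1 leq_add // leq_b1.
  move=> C; rewrite inE => /predU1P[->|Cs].
    by apply/negP => /subsetP/(_ x xB); rewrite !inE eqxx.
  by apply: contra (hD C Cs) => /subset_trans; apply; apply: setDS; apply: subsetUr.
exists D => // C; rewrite inE => /predU1P[->|]; last exact: hD.
by apply: contraFN BU => /subset_trans; apply; exact: subsetDl.
Qed.

End Hitting.

(** * Random sparsification *)

Section Sparsify.
Variables (R : realType) (V : finType) (E : {set {set V}}) (k L N : nat) (B t : R).
Local Notation n := (#|V|%:R : R).
Local Notation p := (N%:R^-1 : R).
Local Notation M := (n / N%:R).
Local Notation D := (16 * k%:R * t).
Hypothesis k_ge4 : (4 <= k)%N.
Hypothesis N_gt0 : (0 < N)%N.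
Hypothesis uniformE : forall e, e \in E -> #|e| = k.
Hypothesis B_gt0 : 0 < B.
Hypothesis M_ge1 : 1 <= M.
Hypothesis t_ge1 : 1 <= t.
Hypothesis degE : forall A : {set V}, (#|A| <= k - 2)%N ->
  (deg E A)%:R <= B * n ^+ (k - 2 - #|A|).
Hypothesis BM : B * M ^+ k.-1 <= t * n ^+ 2.

Let x := 16 * k%:R * B * M ^+ (k - 2) / n.

(** At this threshold [x], on average at most [M / 16] cores are sampled, while any
    other set of [k - 1] sampled vertices lies in at most [16 * k * t] sampled
    edges on average. *)
Definition cores : {set {set V}} := [set S : {set V} | (#|S| == k.-1) && (x < (deg E S)%:R)].
Definition thin_edges : {set {set V}} := [set e in E | [forall S in cores, ~~ (S \subset e)]].

Let p_ge0 : 0 <= p. Proof. by rewrite invr_ge0. Qed.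
Let n_gt0 : 0 < n.
Proof.
rewrite lt_def ler0n andbT; apply: contraTneq M_ge1 => ->.
by rewrite mul0r -ltNge ltr01.
Qed.
Let n_neq0 : n != 0. Proof. by rewrite gt_eqF. Qed.
Let N_neq0 : N%:R != 0 :> R. Proof. by rewrite pnatr_eq0 -lt0n. Qed.
Let k_gt0 : 0 < k%:R :> R. Proof. by rewrite ltr0n; clear - k_ge4; lia. Qed.
Let M_gt0 : 0 < M. Proof. exact: lt_le_trans M_ge1. Qed.
Let t_le : t <= D.
Proof.
have : (1 : R) <= k%:R by rewrite ler1n; clear - k_ge4; lia.
move: t_ge1; nra.
Qed.
Let x_gt0 : 0 < x.
Proof. by rewrite /x !mulr_gt0 ?invr_gt0 ?exprn_gt0 // ltr0n. Qed.

Lemma scaled_degree (j : nat) : (j <= k - 2)%N ->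
  n ^+ (k - 2 - j) * p ^+ (k - j) * n ^+ 2 = M ^+ (k - j).
Proof.
by move=> jk; rewrite mulrAC -exprD exprMn; congr (_ ^+ _ * _); clear - k_ge4 jk; lia.
Qed.

(** The expected number of sampled edges through a given sampled set of [j + 1]
    vertices is at most [t / M ^+ j]. *)
Lemma scaled_degree_le (A : {set V}) (j : nat) : #|A| = j.+1 -> (j < k - 2)%N ->
  (deg E A)%:R * p ^+ (k - j.+1) * M ^+ j <= t.
Proof.
move=> Aj jk; have n2 : 0 < n ^+ 2 by rewrite exprn_gt0.
rewrite -(ler_pM2r n2); apply: le_trans BM.
have -> : k.-1 = (k - j.+1 + j)%N by clear - jk; lia.
rewrite exprD -scaled_degree // -Aj.
have h : (deg E A)%:R <= B * n ^+ (k - 2 - #|A|) by apply: degE; rewrite Aj.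
set a := p ^+ _; set b := M ^+ j; set c := n ^+ 2.
have ha : 0 <= a by rewrite exprn_ge0.
have hb : 0 <= b by rewrite exprn_ge0 // ltW.
have -> : B * (n ^+ (k - 2 - #|A|) * a * c * b) = B * n ^+ (k - 2 - #|A|) * (a * c * b) by ring.
have -> : (deg E A)%:R * a * b * c = (deg E A)%:R * (a * c * b) by ring.
by rewrite ler_wpM2r ?h // !mulr_ge0 // exprn_ge0 // ltW.
Qed.

Lemma card_edges_le_pow : #|E|%:R <= B * n ^+ (k - 2).
Proof.
have := @degE set0; rewrite cards0 subn0 => /(_ isT).
suff -> : deg E set0 = #|E| by [].
by rewrite /deg; apply: eq_card => e; rewrite inE sub0set andbT.
Qed.

Lemma card_edges_le : #|E|%:R * p ^+ k <= t * M.
Proof.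
have n2 : 0 < n ^+ 2 by rewrite exprn_gt0.
rewrite -(ler_pM2r n2).
have -> : t * M * n ^+ 2 = t * n ^+ 2 * M by ring.
apply: le_trans (ler_wpM2r (ltW M_gt0) BM).
have -> : B * M ^+ k.-1 * M = B * M ^+ k by rewrite -mulrA -exprSr prednK //; clear - k_ge4; lia.
have := @scaled_degree 0 isT; rewrite !subn0 => <-.
have -> : B * (n ^+ (k - 2) * p ^+ k * n ^+ 2) = B * n ^+ (k - 2) * (p ^+ k * n ^+ 2) by ring.
by rewrite -[leLHS]mulrA ler_wpM2r ?card_edges_le_pow // mulr_ge0 ?exprn_ge0.
Qed.

Lemma sum_subset_degrees : (\sum_(S : {set V} | #|S| == k.-1) deg E S = k * #|E|)%N.
Proof.
under eq_bigr do rewrite /deg -sum1_card.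
rewrite (exchange_big_dep (mem E)) /=; last by move=> S e _; rewrite inE => /andP[].
rewrite mulnC -sum_nat_const; apply: eq_bigr => e eE.
rewrite sum1_card.
have k0 : (0 < k)%N by apply: leq_trans k_ge4.
have ck : 'C(k, k.-1) = k by rewrite -{1}(prednK k0) binSn prednK.
rewrite -[RHS]ck -[X in 'C(X, _)](uniformE eE) -cards_draws; apply: eq_card => S.
by rewrite !inE unfold_in /= inE eE andbC.
Qed.

Lemma sum_vertex_degrees (F : {set {set V}}) : (forall e, e \in F -> #|e| = k) ->
  (\sum_(v : V) #|[set e in F | v \in e]| = k * #|F|)%N.
Proof.
move=> uF; under eq_bigr do rewrite -sum1_card.
rewrite (exchange_big_dep (mem F)) /=; last by move=> v e _; rewrite inE => /andP[].
rewrite mulnC -sum_nat_const; apply: eq_bigr => e eF.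
rewrite -(uF _ eF) -sum1_card; apply: eq_bigl => v; rewrite inE; exact: andb_idl.
Qed.

(** The degrees of all sets of [k - 1] vertices add up to [k] times the number of
    edges, so few of them exceed [x]. *)
Lemma cores_le : #|cores|%:R * p ^+ k.-1 <= M / 16.
Proof.
have h : #|cores|%:R * x <= k%:R * #|E|%:R.
  rewrite -natrM -sum_subset_degrees natr_sum mulr_natl -sumr_const.
  rewrite big_mkcond [leRHS]big_mkcond; apply: ler_sum => S _.
  rewrite inE; case: (#|S| == k.-1) => //=; case: ltP => [/ltW //|_].
  exact: ler0n.
rewrite -(ler_pM2r x_gt0) mulrAC; apply: (le_trans (ler_wpM2r _ h)).
  by rewrite exprn_ge0.
have -> : M / 16 * x = k%:R * (B * n ^+ (k - 2)) * p ^+ k.-1.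
  have -> : k.-1 = (k - 2).+1 by clear - k_ge4; lia.
  rewrite /x exprMn exprSr; field.
  by rewrite ?n_neq0 ?N_neq0.
by rewrite ler_wpM2r ?exprn_ge0 // ler_wpM2l // card_edges_le_pow.
Qed.

Lemma deg_thin_le (A : {set V}) : (deg thin_edges A <= deg E A)%N.
Proof. by apply: subset_leq_card; apply/subsetP => e; rewrite !inE -andbA => /and3P[-> _ ->]. Qed.

Lemma thin_edges_uniform e : e \in thin_edges -> #|e| = k.
Proof. by rewrite inE => /andP[/uniformE]. Qed.

(** Sets of [k - 1] vertices are the only ones whose degree is not controlled by
    the hypothesis on smaller sets; for them the removal of the cores gives the
    bound. *)
Lemma deg_thin1 (A : {set V}) : (0 < #|A|)%N -> (deg thin_edges A)%:R * p ^+ (k - #|A|) <= D.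
Proof.
move=> A0; apply: (@le_trans _ _ ((deg thin_edges A)%:R * p ^+ (k - #|A|) * M ^+ 0)).
  by rewrite mulr1.
case: (ltnP #|A| k.-1) => Ak.
  apply: (@le_trans _ _ ((deg E A)%:R * p ^+ (k - #|A|) * M ^+ #|A|.-1)).
    apply: ler_pM; first by rewrite mulr_ge0 ?exprn_ge0.
    - by rewrite exprn_ge0 // ltW.
    - by rewrite ler_wpM2r ?exprn_ge0 // ler_nat deg_thin_le.
    by rewrite expr0 exprn_ege1.
  apply: le_trans t_le; have := @scaled_degree_le A #|A|.-1; rewrite prednK //; apply => //.
  by clear - Ak A0; lia.
case: (ltnP #|A| k) => Ak'.
  have {Ak Ak'} Ak : #|A| = k.-1 by clear - Ak Ak'; lia.
  rewrite expr0 mulr1; case: (boolP (A \in cores)) => [Ac|].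
    suff -> : deg thin_edges A = 0%N by rewrite mul0r; apply: le_trans t_le; apply: le_trans t_ge1.
    apply/eqP; rewrite cards_eq0; apply/eqP/setP => e; rewrite !inE.
    apply/negP => /andP[/andP[_ /forall_inP/(_ A Ac)/negP]]; exact.
  rewrite inE Ak eqxx /= -leNgt => dA.
  have -> : (k - k.-1 = 1)%N by clear - k_ge4; lia.
  rewrite expr1; apply: (@le_trans _ _ (x * p)).
    by rewrite ler_wpM2r //; apply: le_trans dA; rewrite ler_nat deg_thin_le.
  have n2 : 0 < n ^+ 2 by rewrite exprn_gt0.
  rewrite -(ler_pM2r n2); apply: (@le_trans _ _ (16 * k%:R * (B * M ^+ k.-1))); last first.
    by rewrite -[leRHS]mulrA ler_wpM2l // mulr_ge0.
  have -> : k.-1 = (k - 2).+1 by clear - k_ge4; lia.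
  rewrite /x (exprSr M (k - 2)); set y := M ^+ (k - 2); rewrite le_eqVlt; apply/orP; left; apply/eqP.
  by field; rewrite ?n_neq0 ?N_neq0.
have -> : (k - #|A| = 0)%N by clear - Ak'; lia.
rewrite !expr0 !mulr1; apply: le_trans t_le; apply: le_trans t_ge1; rewrite lern1.
rewrite -(cards1 A); apply: subset_leq_card; apply/subsetP => e; rewrite !inE => /andP[/andP[eE _] Ae].
by rewrite eq_sym eqEcard Ae (uniformE eE).
Qed.

Lemma deg_thin2 (A : {set V}) : (2 <= #|A| <= k - 2)%N ->
  (deg thin_edges A)%:R * p ^+ (k - #|A|) <= D / M.
Proof.
case/andP=> A2 Ak; rewrite ler_pdivlMr //; apply: le_trans t_le.
have := @scaled_degree_le A #|A|.-1; rewrite prednK; last by clear - A2; lia.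
move=> /(_ erefl) h; apply: le_trans (h _); last by clear - A2 Ak; lia.
apply: ler_pM; first by rewrite mulr_ge0 ?exprn_ge0.
- exact: ltW.
- by rewrite ler_wpM2r ?exprn_ge0 // ler_nat deg_thin_le.
by rewrite -[leLHS]expr1 ler_weXn2l //; clear - A2; lia.
Qed.

Hypothesis rare : L%:R * (D * (2 ^+ (k * L) * D) ^+ L) <= M / 16.

Let D_ge1 : 1 <= D. Proof. exact: le_trans t_ge1 t_le. Qed.
Let D_ge0 : 0 <= D. Proof. exact: le_trans D_ge1. Qed.

Definition forbidden : seq {set V} :=
  enum cores ++ flatten [seq violations k thin_edges l.+1 | l <- iota 0 L].

Lemma forbidden_neq0 : all (fun A : {set V} => A != set0) forbidden.
Proof.
rewrite all_cat; apply/andP; split.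
  apply/allP => S; rewrite mem_enum inE => /andP[/eqP Sk _].
  by rewrite -card_gt0 Sk; clear - k_ge4; lia.
apply/allP => W /flattenP[_ /mapP[l _ ->]] /allpairsPdep[hs [e [_]]].
rewrite mem_filter mem_enum => /andP[_ eH] ->; rewrite -card_gt0.
by apply: leq_trans (subset_leq_card (subsetUl e _)); rewrite (thin_edges_uniform eH); clear - k_ge4; lia.
Qed.

Lemma weight_forbidden : \sum_(A <- forbidden) p ^+ #|A| <= M / 8.
Proof.
have -> : M / 8 = M / 16 + M / 16 by field.
rewrite big_cat lerD //=.
  apply: le_trans cores_le.
  rewrite big_enum /= mulr_natl -sumr_const le_eqVlt; apply/orP; left; apply/eqP.
  by apply: eq_bigr => S; rewrite inE => /andP[/eqP ->].
apply: le_trans rare; rewrite big_flatten big_map.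
apply: (@le_trans _ _ (\sum_(l <- iota 0 L) (D * (2 ^+ (k * L) * D) ^+ L))); last first.
  by rewrite big_const_seq count_predT size_iota iter_addr_0 [leRHS]mulr_natl lexx.
have Q1 : 1 <= 2 ^+ (k * L) * D.
  by rewrite -[leLHS]mulr1 ler_pM // exprn_ege1 // ler1n.
rewrite big_seq [leRHS]big_seq; apply: ler_sum => l; rewrite mem_iota add0n => /andP[_ lL].
have hE : #|thin_edges|%:R * p ^+ k <= D * M.
  apply: le_trans (le_trans card_edges_le _); last by rewrite ler_wpM2r // ltW.
  rewrite ler_wpM2r ?exprn_ge0 // ler_nat.
  by apply: subset_leq_card; apply/subsetP => e; rewrite inE => /andP[].
apply: (le_trans (sum_violations_le p_ge0 thin_edges_uniform M_gt0 D_ge0 hE deg_thin1 deg_thin2 lL)).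
by rewrite ler_wpM2l // ler_weXn2l.
Qed.

Definition induced (U : {set V}) : {set {set V}} := [set e in E | e \subset U].

(** Sample each vertex with probability [1 / N] and delete a vertex of each sampled
    core and of each sampled violation, and the vertices of degree above
    [16 * k * t]. On average this removes less than half of the [M] vertices
    sampled. *)
Lemma sparsify : exists U : {set V},
  [/\ M / 2 <= #|U|%:R, locally_sparse (induced U) k L &
      forall v, #|[set e in induced U | v \in e]|%:R <= D].
Proof.
pose zeros (w : {ffun V -> 'I_N}) : {set V} := [set v | val (w v) == 0%N].
have PrW (W : {set V}) : Pr R (fun w : {ffun V -> 'I_N} => W \subset zeros w) = p ^+ #|W|.
  rewrite exprVn -(Pr_monochromatic R N_gt0 W N_gt0); apply: eq_Pr => w.
  apply/subsetP/forall_inP => h v vW; first by have := h v vW; rewrite inE.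
  by rewrite inE; exact: h.
have D_gt0 : 0 < D by exact: lt_le_trans D_ge1.
have [w] := Ex_exists N_gt0 (fun w =>
  (\sum_(v : V) ([set v] \subset zeros w)%:R -
   \sum_(A <- forbidden) (A \subset zeros w)%:R) -
   (k%:R / D) * \sum_(e in E) (e \subset zeros w)%:R : R).
rewrite !ExB ExZ !Ex_sum.
have -> : \sum_v Ex (fun w : {ffun V -> 'I_N} => ([set v] \subset zeros w)%:R) = M.
  under eq_bigr do rewrite [Ex _]PrW cards1 expr1.
  by rewrite sumr_const mulr_natl.
have -> : \sum_(A <- forbidden) Ex (fun w : {ffun V -> 'I_N} => (A \subset zeros w)%:R) =
   \sum_(A <- forbidden) p ^+ #|A|.
  by apply: eq_bigr => A _; exact: PrW.
have -> : \sum_(e in E) Ex (fun w : {ffun V -> 'I_N} => (e \subset zeros w)%:R) = #|E|%:R * p ^+ k.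
  rewrite mulr_natl -sumr_const; apply: eq_bigr => e eE.
  by rewrite [LHS]PrW (uniformE eE).
set U0 := zeros w; set a := \sum_(v : V) _; set b := \sum_(A <- _) _; set c := \sum_(e in E) _.
have aE : a = #|U0|%:R.
  rewrite /a -natr_sum -sum1_card [in RHS]big_mkcond; congr (_%:R); apply: eq_bigr => v _.
  by rewrite sub1set; case: (v \in U0).
have bE : b = (count (fun A : {set V} => A \subset U0) forbidden)%:R.
  by rewrite /b -natr_sum -sum1_count [in RHS]big_mkcond; congr (_%:R); apply: eq_bigr => A _; case: (_ \subset _).
have cE : c = #|induced U0|%:R.
  rewrite /c -natr_sum -sum1_card big_mkcond [in RHS]big_mkcond; congr (_%:R); apply: eq_bigr => e _.
  by rewrite inE; case: (e \in E) => //=; case: (_ \subset _).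
have hw := weight_forbidden; have hE := card_edges_le.
have kD : k%:R / D * (#|E|%:R * p ^+ k) <= M / 16.
  apply: (@le_trans _ _ (k%:R / D * (t * M))); first by rewrite ler_wpM2l // divr_ge0.
  rewrite le_eqVlt; apply/orP; left; apply/eqP; field.
  by rewrite ?N_neq0 ?gt_eqF // (lt_le_trans _ t_ge1).
move=> h.
have [D0 cD0 hD0] := hitting_set U0 forbidden_neq0.
pose heavy := [set v in U0 | D < #|[set e in induced U0 | v \in e]|%:R].
have cheavy : #|heavy|%:R <= k%:R / D * c.
  rewrite mulrAC ler_pdivlMr // cE -[leRHS]natrM -(@sum_vertex_degrees (induced U0)); last first.
    by move=> e; rewrite inE => /andP[/uniformE].
  rewrite natr_sum [leLHS]mulr_natl -sumr_const big_mkcond /=; apply: ler_sum => v _.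
  by rewrite inE; case: (v \in U0) => //=; case: ltP => // /ltW.
pose U := U0 :\: (D0 :|: heavy).
have UU0 : U \subset U0 by exact: subsetDl.
have sub_ind : induced U \subset induced U0.
  by apply/subsetP => e; rewrite !inE => /andP[-> /subset_trans]; apply.
exists U; split.
- have : #|U0|%:R - (#|D0|%:R + #|heavy|%:R) <= #|U|%:R :> R.
    rewrite lerBlDr -!natrD ler_nat.
    have := cardsID (D0 :|: heavy) U0; have := cardsU D0 heavy.
    have := subset_leq_card (subsetIr U0 (D0 :|: heavy)); rewrite -/U; clear; lia.
  have cD0' : #|D0|%:R <= b by rewrite bE ler_nat.
  move: h hw kD cheavy cD0' M_gt0; rewrite aE; lra.
- have -> : induced U = [set e in thin_edges | e \subset U].
    apply/setP => e; rewrite !inE -andbA; case eE: (e \in E) => //=.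
    case eU: (e \subset U); rewrite ?andbF // andbT; apply/esym/forall_inP => S Sc.
    apply/negP => Se; have : S \in forbidden by rewrite mem_cat mem_enum Sc.
    move=> /hD0/negP; apply; apply: subset_trans Se (subset_trans eU _).
    by apply: setDS; exact: subsetUl.
  apply: chain_violation => W l lL Wv.
  have : W \in forbidden.
    rewrite mem_cat; apply/orP; right; apply/flattenP; exists (violations k thin_edges l.+1) => //.
    by apply/mapP; exists l; rewrite // mem_iota.
  move=> /hD0; apply: contra => /subset_trans; apply.
  by apply: setDS; exact: subsetUl.
- move=> v; case: (boolP (v \in U)) => [|vU].
    rewrite !inE !negb_or negb_and => /andP[/andP[_]] /orP[/negbTE -> //|].
    rewrite -leNgt => + _; apply: le_trans; rewrite ler_nat; apply: subset_leq_card.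
    by apply/subsetP => e; rewrite !inE => /andP[eU ->]; have := subsetP sub_ind e; rewrite !inE => ->.
  suff -> : [set e in induced U | v \in e] = set0 by rewrite cards0.
  apply/setP => e; rewrite !inE; apply/negP => /andP[/andP[_ /subsetP eU] /eU].
  by rewrite (negbTE vU).
Qed.

End Sparsify.

(** * Numerical constraints on the selection rate *)

Section Numeric.
Variables (R : realType) (k : nat) (x s : R).
Hypothesis k_ge4 : (4 <= k)%N.
Hypothesis x_ge : 2000 * k%:R ^+ 3 * 10 ^+ k <= x.
Hypothesis s_gt0 : 0 < s.
Hypothesis sE : s ^+ k.-1 * (128 * k%:R ^+ 2 * 8 ^+ k.-1) = ln x.

Let q : R := (x ^+ 3)^-1.
Let g : R := s / x.
Let D : R := 16 * k%:R * (2 * x) ^+ k.-1.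
Let G : R := 2 * (g + q).

Let k1 : 4 <= k%:R :> R. Proof. by rewrite ler_nat. Qed.
Let p10 : 1 <= 10 ^+ k :> R. Proof. by rewrite exprn_ege1 // ler1n. Qed.
Let k3 : 1 <= k%:R ^+ 3 :> R. Proof. by rewrite exprn_ege1 // ler1n; clear - k_ge4; lia. Qed.
Let xk : 2000 * k%:R ^+ 3 <= x.
Proof.
apply: le_trans x_ge; rewrite -[leLHS]mulr1 ler_wpM2l //.
by rewrite mulr_ge0 // exprn_ge0.
Qed.
Let x2000 : 2000 <= x. Proof. by apply: le_trans xk; rewrite -[leLHS]mulr1 ler_wpM2l. Qed.
Let x_gt0 : 0 < x. Proof. by apply: lt_le_trans x2000; rewrite ltr0n. Qed.

Let x_ge0 : 0 <= x. Proof. exact: ltW. Qed.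
Let s_ge0 : 0 <= s. Proof. exact: ltW. Qed.
Let w_ge1 : 1 <= 128 * k%:R ^+ 2 * 8 ^+ k.-1 :> R.
Proof.
have : 1 <= k%:R ^+ 2 :> R by rewrite exprn_ege1 // ler1n; clear - k_ge4; lia.
have : 1 <= 8 ^+ k.-1 :> R by rewrite exprn_ege1 // ler1n.
move=> h8 h2; rewrite -[leLHS]mulr1 ler_pM // -[leLHS]mulr1 ler_pM //.
by rewrite ler1n.
Qed.

Lemma s_pow_le_ln : s ^+ k.-1 <= ln x.
Proof. by rewrite -sE ler_peMr // exprn_ge0 // ltW. Qed.

Lemma s_pow_le (j : nat) : (j <= k.-1)%N -> s ^+ j <= x.
Proof.
move=> jk; case: (leP s 1) => s1.
  by apply: le_trans (exprn_ile1 _ (ltW s_gt0) s1) _; move: x2000; lra.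
apply: (@le_trans _ _ (s ^+ k.-1)); first by rewrite ler_weXn2l // ltW.
by apply: le_trans s_pow_le_ln _; rewrite ltW // ln_sublinear.
Qed.

Lemma ln_x_ge1 : 1 <= ln x.
Proof.
rewrite -[leLHS](@expRK R) ler_ln ?posrE ?expR_gt0 //.
have h : 1 / 2 <= expR (- (1 / 2)) :> R.
  by apply: le_trans (expR_ge1Dx _); lra.
have e2 : expR (1 / 2) <= 2 :> R.
  rewrite -[leLHS]invrK -expRN invf_ple ?posrE ?expR_gt0 //.
  by apply: le_trans h; lra.
have -> : 1 = 1 / 2 + 1 / 2 :> R by field.
rewrite expRD; apply: le_trans (ler_pM _ _ e2 e2) _; rewrite ?expR_ge0 //.
by move: x2000; lra.
Qed.

(** A single round is shorter than the target selection probability. *)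
Lemma q_le_g : q <= g.
Proof.
have s2 : 1 <= s * x ^+ 2.
  case: (leP 1 s) => s1.
    by rewrite -[leLHS]mulr1 ler_pM // exprn_ege1 //; move: x2000; lra.
  have hs : s ^+ k.-1 <= s.
    by rewrite -[leRHS]expr1 ler_wiXn2l ?(ltW s1) //; clear - k_ge4; lia.
  have w_le : 128 * k%:R ^+ 2 * 8 ^+ k.-1 <= x ^+ 2.
    have h8 : 8 ^+ k.-1 <= 10 ^+ k :> R.
      apply: (@le_trans _ _ (10 ^+ k.-1)); first by rewrite lerXn2r ?nnegrE ?ler_nat.
      by rewrite ler_weXn2l ?ler1n // leq_pred.
    have hk : k%:R ^+ 2 <= k%:R ^+ 3 :> R by rewrite ler_weXn2l // (le_trans _ k1) // ler1n.
    apply: (@le_trans _ _ (2000 * k%:R ^+ 3 * 10 ^+ k)).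
      apply: ler_pM h8; rewrite ?mulr_ge0 ?exprn_ge0 //.
      by apply: ler_pM hk; rewrite ?exprn_ge0 ?ler_nat.
    apply: le_trans x_ge _; rewrite expr2 ler_peMl // //.
    by move: x2000; lra.
  apply: le_trans ln_x_ge1 _; rewrite -sE; apply: ler_pM => //.
    by rewrite exprn_ge0 // ltW.
  by apply: le_trans w_ge1.
rewrite /q /g ler_pdivlMr // exprSr invfM mulfVK ?gt_eqF //.
by rewrite -[leLHS]mul1r ler_pdivrMr ?exprn_gt0.
Qed.

Let g_gt0 : 0 < g. Proof. by rewrite divr_gt0. Qed.
Let q_gt0 : 0 < q. Proof. by rewrite invr_gt0 exprn_gt0. Qed.
Let G_ge0 : 0 <= G. Proof. by rewrite /G; move: q_gt0 g_gt0; lra. Qed.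
Let G_le : G <= 4 * g. Proof. by rewrite /G; move: q_le_g; lra. Qed.
Let Gq_le : G + q <= 5 * g. Proof. by move: q_le_g G_le; lra. Qed.
Let Gq_ge0 : 0 <= G + q. Proof. by rewrite addr_ge0 // ltW. Qed.
Let D_gt0 : 0 < D.
Proof. by rewrite /D !mulr_gt0 ?exprn_gt0 ?mulr_gt0 // ltr0n; clear - k_ge4; lia. Qed.

Let D_ge0 : 0 <= D. Proof. exact: ltW. Qed.
Let g_ge0 : 0 <= g. Proof. exact: ltW. Qed.
Let q_ge0 : 0 <= q. Proof. exact: ltW. Qed.

(** Here and in the next two lemmas, [x] is the oversampling factor, [x ^+ 3] is
    the number of rounds, and [s / x] is the selection probability aimed at. These
    are the hypotheses under which the process reaches it on a hypergraph of
    maximum degree [16 * k * (2 * x) ^+ (k - 1)]. *)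
Lemma rate_small : k%:R * (G + q) <= 1 / 2.
Proof.
apply: (@le_trans _ _ (k%:R * (5 * g))); first by rewrite ler_wpM2l.
have h : 10 * k%:R * s <= x.
  rewrite -(@ler_pXn2r _ 3) ?nnegrE ?mulr_ge0 //.
  have s3 := @s_pow_le 3; rewrite !exprMn.
  apply: (@le_trans _ _ (2000 * k%:R ^+ 3 * x)).
    apply: ler_pM; rewrite ?mulr_ge0 ?exprn_ge0 //; last by apply: s3; clear - k_ge4; lia.
    by rewrite ler_wpM2r ?exprn_ge0 // -natrX ler_nat.
  have x1 : 1 <= x by move: x2000; lra.
  have : x * x <= x ^+ 3 by rewrite -expr2 ler_weXn2l.
  apply: le_trans; rewrite ler_wpM2r // ltW.
have -> : k%:R * (5 * g) = 10 * k%:R * s / x / 2 by rewrite /g; field; rewrite gt_eqF.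
by rewrite ler_wpM2r ?invr_ge0 // ler_pdivrMr // mul1r.
Qed.

Lemma round_loss_small : 2 * (G + q) ^+ (k - 2) * (D * k%:R * q) <= 1 / 2.
Proof.
apply: (@le_trans _ _ (2 * (5 * g) ^+ (k - 2) * (D * k%:R * q))).
  have Dkq : 0 <= D * k%:R * q by apply: mulr_ge0 => //; apply: mulr_ge0.
  by rewrite (ler_wpM2r Dkq) // ler_wpM2l // lerXn2r // nnegrE mulr_ge0.
have -> : 2 * (5 * g) ^+ (k - 2) * (D * k%:R * q) =
   64 * k%:R ^+ 2 * (5 ^+ (k - 2) * 2 ^+ (k - 2)) * s ^+ (k - 2) / x ^+ 2.
  rewrite /D /g /q; have -> : k.-1 = (k - 2).+1 by clear - k_ge4; lia.
  rewrite !exprMn exprVn (exprS 2 (k - 2)) (exprS x (k - 2)).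
  set a := _ ^+ (k - 2); set b := _ ^+ (k - 2); set c := _ ^+ (k - 2); set d := _ ^+ (k - 2).
  have : x ^+ (k - 2) != 0 by rewrite expf_neq0 // gt_eqF.
  rewrite -/c -/d -/a -/b => h.
  by field; rewrite h andbT gt_eqF.
rewrite -exprMn; have -> : 5 * 2 = 10 :> R by rewrite -natrM.
rewrite ler_pdivrMr ?exprn_gt0 //.
have h10 : 10 ^+ (k - 2) <= 10 ^+ k :> R by rewrite ler_weXn2l ?ler1n // leq_subr.
have hk : k%:R ^+ 2 <= k%:R ^+ 3 :> R by rewrite ler_weXn2l // (le_trans _ k1) // ler1n.
have hs : s ^+ (k - 2) <= x by apply: s_pow_le; clear - k_ge4; lia.
apply: (@le_trans _ _ ((1 / 2 * x) * x)); last by rewrite expr2 mulrA.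
apply: ler_pM => //; first by rewrite !mulr_ge0 ?exprn_ge0.
  by rewrite exprn_ge0 // ltW.
apply: (@le_trans _ _ (64 * k%:R ^+ 3 * 10 ^+ k)).
  by apply: ler_pM; rewrite ?mulr_ge0 ?exprn_ge0 // ler_wpM2l.
move: x_ge; have : 0 <= k%:R ^+ 3 * 10 ^+ k :> R by rewrite mulr_ge0 ?exprn_ge0.
rewrite -!mulrA; set a := _ * _; lra.
Qed.

(** With [s ^+ (k - 1)] a small multiple of [ln x], the exponent is at most
    [ln x / 2], so that a vertex stays unblocked with probability at least
    [1 / sqrt x]. This exceeds [2 * s / x] because [s ^+ 3 <= x]. *)
Lemma rate_le_survival : g <= expR (- (4 * G ^+ (k - 2) * (D * k%:R * G))) / 2.
Proof.
apply: (@le_trans _ _ (expR (- (ln x / 2)) / 2)); last first.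
  rewrite ler_wpM2r ?invr_ge0 // ler_expR lerN2.
  have -> : 4 * G ^+ (k - 2) * (D * k%:R * G) = 4 * D * k%:R * G ^+ k.-1.
    have -> : k.-1 = (k - 2).+1 by clear - k_ge4; lia.
    by rewrite exprSr; ring.
  apply: (@le_trans _ _ (4 * D * k%:R * (4 * g) ^+ k.-1)).
    have Dk : 0 <= 4 * D * k%:R by apply: mulr_ge0 => //; apply: mulr_ge0.
    by rewrite (ler_wpM2l Dk) // lerXn2r // nnegrE mulr_ge0.
  rewrite -sE /D /g !exprMn exprVn.
  have -> : 8 = 2 * 4 :> R by rewrite -natrM.
  rewrite exprMn; set a := 2 ^+ _; set b := 4 ^+ _; set c := s ^+ _.
  have : x ^+ k.-1 != 0 by rewrite expf_neq0 // gt_eqF.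
  set y := x ^+ k.-1 => h; rewrite le_eqVlt; apply/orP; left; apply/eqP.
  by field.
rewrite ler_pdivlMr // /g.
rewrite -(@ler_pXn2r _ 2) ?nnegrE ?expR_ge0 ?mulr_ge0 ?invr_ge0 //.
have -> : expR (- (ln x / 2)) ^+ 2 = x^-1.
  rewrite -expRM_natl; have -> : 2%:R * - (ln x / 2) = - ln x by field.
  by rewrite expRN lnK ?posrE.
have -> : (s / x * 2) ^+ 2 = 4 * s ^+ 2 / x / x by field; rewrite gt_eqF.
rewrite ler_pdivrMr // mulVf ?gt_eqF // ler_pdivrMr // mul1r.
rewrite -(@ler_pXn2r _ 3) ?nnegrE ?mulr_ge0 ?exprn_ge0 //.
have s3 : s ^+ 3 <= x by apply: s_pow_le; clear - k_ge4; lia.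
have -> : (4 * s ^+ 2) ^+ 3 = 64 * (s ^+ 3 * s ^+ 3) by ring.
have -> : x ^+ 3 = x * (x * x) by ring.
apply: ler_pM => //; rewrite ?mulr_ge0 ?exprn_ge0 //.
  by move: x2000; lra.
by apply: ler_pM => //; rewrite exprn_ge0 // ltW.
Qed.

End Numeric.

(** * The bound at a fixed scale *)

Lemma deg_extend (V : finType) (E : {set {set V}}) (k c : nat) (A : {set V}) :
  (forall e, e \in E -> #|e| = k) -> (#|A| < k)%N ->
  (forall v, v \notin A -> (deg E (v |: A) <= c)%N) -> (deg E A <= c * #|V|)%N.
Proof.
move=> uE Ak hc.
apply: (@leq_trans (\sum_(v : V | v \notin A) deg E (v |: A))); last first.
  apply: (@leq_trans (\sum_(v : V | v \notin A) c)); first exact: leq_sum.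
  by rewrite sum_nat_const mulnC leq_mul2l max_card orbT.
under eq_bigr do rewrite /deg -sum1_card.
rewrite (exchange_big_dep [in [set e in E | A \subset e]]) /=; last first.
  by move=> v e _; rewrite !inE subUset => /and3P[-> _ ->].
rewrite {1}/deg -sum1_card; apply: leq_sum => e; rewrite inE => /andP[eE Ae].
have /card_gt0P[v] : (0 < #|e :\: A|)%N.
  by rewrite cardsD (setIidPr Ae) (uE _ eE) subn_gt0.
rewrite inE => /andP[vA ve]; rewrite (bigD1 v) //= vA inE eE subUset sub1set ve.
exact: Ae.
Qed.

Lemma deg_le_max_degree (k : nat) (V : finType) (H : kgraph k V) (A : {set V}) :
  (#|A| <= k - 2)%N -> (2 <= k)%N ->
  (deg (edges H) A <= max_degree H (k - 2) * #|V| ^ (k - 2 - #|A|))%N.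
Proof.
move=> Ak k2; move: {2}(k - 2 - #|A|)%N (erefl (k - 2 - #|A|)%N) => i.
have uH e : e \in edges H -> #|e| = k.
  by move=> eH; apply/eqP; exact: (forall_inP (edges_uniform H)).
elim: i A Ak => [|i IH] A Ak iE.
  rewrite iE expn0 muln1; apply: (@leq_bigmax_cond _ _ (degree H)).
  by apply/eqP; clear - Ak iE; lia.
rewrite iE expnSr mulnA; apply: (deg_extend uH); first by clear - Ak k2; lia.
move=> v vA; have cA : #|v |: A| = #|A|.+1 by rewrite cardsU1 vA.
have := IH (v |: A); rewrite cA; have -> : (k - 2 - #|A|.+1 = i)%N by clear - iE; lia.
by apply=> //; clear - iE; lia.
Qed.

(** By [T <= 2 ^ T], every factor is at most a power of two with an exponent
    polynomial in [T]; the power [T ^ 6] comes from the exponent [k * L * L]. *)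
Lemma violation_weight_le (k T D L : nat) : (4 <= k)%N -> (16 * k <= T)%N -> (64 <= T)%N ->
  (D = 16 * k * (2 * T) ^ k.-1)%N -> (L = 4 * T ^ 3)%N ->
  (16 * (L * (D * (2 ^ (k * L) * D) ^ L)) <= 2 ^ (27 * k * T ^ 6))%N.
Proof.
move=> k4 Tk T64 DE LE.
have T1 : (0 < T)%N by clear - T64; lia.
have T2 : (T <= 2 ^ T)%N by exact: ltnW (ltn_expl _ _).
have D_le : (D <= 2 ^ (2 * k * T))%N.
  apply: (@leq_trans (T * (T * T) ^ k.-1)).
    by rewrite DE; apply: leq_mul => //; rewrite leq_exp2r ?leq_mul2r; clear - k4 T64; lia.
  apply: (@leq_trans (T ^ (2 * k))).
    by rewrite mulnn -expnM -expnS leq_pexp2l //; clear - k4; lia.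
  apply: (@leq_trans ((2 ^ T) ^ (2 * k))); first by rewrite leq_exp2r //; clear -k4; lia.
  by rewrite -expnM mulnC.
have T13 : (T <= T ^ 3)%N by rewrite -[leqLHS]expn1 leq_pexp2l.
have T16 : (T <= T ^ 6)%N by rewrite -[leqLHS]expn1 leq_pexp2l.
have Q_le : (2 ^ (k * L) * D <= 2 ^ (6 * k * T ^ 3))%N.
  apply: (@leq_trans (2 ^ (k * L) * 2 ^ (2 * k * T))); first by rewrite leq_mul2l D_le orbT.
  rewrite -expnD leq_exp2l // LE.
  have := leq_mul (leqnn (2 * k)) T13; set y := (T ^ 3)%N; clear; nia.
have QL_le : ((2 ^ (k * L) * D) ^ L <= 2 ^ (24 * k * T ^ 6))%N.
  apply: (@leq_trans ((2 ^ (6 * k * T ^ 3)) ^ L)).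
    by rewrite leq_exp2r // LE muln_gt0 expn_gt0 T1.
  rewrite -expnM leq_exp2l // LE (_ : T ^ 6 = T ^ 3 * T ^ 3)%N ?expnD //; last by rewrite -expnD.
  set y := (T ^ 3)%N; clear; nia.
have LD : (16 * L * D <= 2 ^ (3 * k * T ^ 6))%N.
  apply: (@leq_trans (2 ^ (4 * T) * 2 ^ (2 * k * T))).
    apply: leq_mul D_le; apply: (@leq_trans (T ^ 4)).
      by rewrite LE expnS mulnA leq_mul2r; apply/orP; right; clear - T64; lia.
    by apply: leq_trans (_ : (2 ^ T) ^ 4 <= _)%N; rewrite ?leq_exp2r // -expnM mulnC.
  rewrite -expnD leq_exp2l //; apply: (@leq_trans (3 * k * T)%N).
    by rewrite -mulnDl leq_mul2r; apply/orP; right; clear - k4; lia.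
  by rewrite leq_mul2l T16 orbT.
rewrite !mulnA; apply: leq_trans (leq_mul LD QL_le) _.
rewrite -expnD leq_exp2l //; set y := (T ^ 6)%N; clear; nia.
Qed.

Section LowerBound.
Variables (R : realType) (k : nat) (V : finType) (H : kgraph k V) (d m s : R) (T : nat).
Local Notation n := (#|V|%:R : R).
Local Notation x := (T%:R : R).
Hypothesis k_ge4 : (4 <= k)%N.
Hypothesis d_gt0 : 0 < d.
Hypothesis dn_ge1 : 1 <= d * n.
Hypothesis max_degH : (max_degree H (k - 2))%:R <= d * n.
Hypothesis m_ge0 : 0 <= m.
Hypothesis mE : m ^+ k.-1 = n / d.
Hypothesis T_ge : (2000 * k ^ 3 * 10 ^ k <= T)%N.
Hypothesis T_le : (2 ^ (27 * k ^ 2 * T ^ 6))%:R <= n / d.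
Hypothesis s_gt0 : 0 < s.
Hypothesis sE : s ^+ k.-1 * (128 * k%:R ^+ 2 * 8 ^+ k.-1) = ln x.

Let T_large : (16 * k <= T)%N /\ (64 <= T)%N.
Proof.
have k3 : (k <= k ^ 3)%N by rewrite -[leqLHS]expn1 leq_pexp2l //; clear - k_ge4; lia.
have p10 : (1 <= 10 ^ k)%N by rewrite expn_gt0.
have h : (2000 * k <= T)%N.
  apply: leq_trans T_ge; rewrite -[leqLHS]muln1; apply: leq_mul => //.
  by rewrite leq_mul2l k3 orbT.
by split; clear - h k_ge4; lia.
Qed.

Let T_gt0 : (0 < T)%N. Proof. by case: T_large => _; apply: leq_trans. Qed.
Let x_ge1 : 1 <= x. Proof. by rewrite ler1n. Qed.
Let x_gt0 : 0 < x. Proof. by rewrite ltr0n. Qed.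
Let n_gt0 : 0 < n.
Proof. by have : 0 < d * n by [exact: lt_le_trans dn_ge1]; rewrite pmulr_rgt0. Qed.

Let x_ge0 : 0 <= x. Proof. exact: ltW. Qed.

Let m_large : (2 ^ (27 * k * T ^ 6))%:R <= m.
Proof.
rewrite -(@ler_pXn2r _ k.-1) ?nnegrE ?ler0n //; last by clear - k_ge4; lia.
rewrite mE; apply: le_trans T_le; rewrite -natrX ler_nat -expnM leq_exp2l //.
apply: (@leq_trans (27 * k * T ^ 6 * k)); first by rewrite leq_mul2l leq_pred orbT.
by rewrite mulnAC -[(27 * k * k)%N]mulnA mulnn.
Qed.

Let m_gt0 : 0 < m.
Proof. by apply: lt_le_trans m_large; rewrite ltr0n expn_gt0. Qed.

Let nd_le : n / d <= n ^+ 2.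
Proof.
rewrite ler_pdivrMr // expr2 -mulrA; apply: ler_peMr; first exact: ltW.
by rewrite mulrC.
Qed.

Let mx_le_n : m * x <= n.
Proof.
rewrite -(@ler_pXn2r _ 3) ?nnegrE ?mulr_ge0 //.
have m1 : 1 <= m by apply: le_trans m_large; rewrite ler1n expn_gt0.
have hm : m ^+ 3 <= n ^+ 2.
  apply: le_trans nd_le; rewrite -mE ler_weXn2l //.
  by clear - k_ge4; lia.
have hx : x ^+ 3 <= n.
  rewrite -(@ler_pXn2r _ 2) ?nnegrE ?exprn_ge0 //.
  rewrite -exprM; apply: le_trans nd_le; apply: le_trans T_le.
  rewrite -natrX ler_nat; apply: leq_trans (ltnW (ltn_expl _ (leqnn 2))) _.
  rewrite leq_exp2l // leq_pmull // muln_gt0 /= expn_gt0.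
  by clear - k_ge4; lia.
rewrite exprMn (exprSr n 2); apply: ler_pM hm hx; exact: exprn_ge0.
Qed.

(** On average the sample has between [m * T] and [2 * m * T] vertices; half of
    them survive the sparsification, and the process keeps a proportion [s / T]. *)
Lemma alpha_ge_scale : m * s / 2 <= (alpha H)%:R.
Proof.
pose N := Num.truncn (n / (m * x)).
have mx_gt0 : 0 < m * x by rewrite mulr_gt0.
have nmx_ge1 : 1 <= n / (m * x) by rewrite ler_pdivlMr // mul1r.
have N_gt0 : (0 < N)%N by rewrite truncn_gt0.
have /truncn_itv/andP[N_le N_gt] : 0 <= n / (m * x) by apply: le_trans nmx_ge1.
have NR : 0 < N%:R :> R by rewrite ltr0n.
pose M := n / N%:R.
have M_ge : m * x <= M by rewrite /M ler_pdivlMr // mulrC -ler_pdivlMr.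
have M_le : M <= m * (2 * x).
  rewrite /M ler_pdivrMr //.
  have : n / (m * x) <= 2 * N%:R.
    apply: (le_trans (ltW N_gt)); rewrite -/N -natrM ler_nat; clear - N_gt0; lia.
  rewrite ler_pdivrMr // => h; apply: le_trans h _.
  by rewrite le_eqVlt; apply/orP; left; apply/eqP; ring.
have M_ge1 : 1 <= M.
  apply: le_trans M_ge; rewrite -[leLHS]mulr1 ler_pM //.
  by apply: le_trans m_large; rewrite ler1n expn_gt0.
pose t : R := (2 * x) ^+ k.-1.
have t_ge1 : 1 <= t by rewrite exprn_ege1 // -natrM ler1n; clear -T_gt0; lia.
have uH e : e \in edges H -> #|e| = k.
  by move=> eH; apply/eqP; exact: (forall_inP (edges_uniform H)).
have k2 : (2 <= k)%N by apply: leq_trans k_ge4.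
have degH (A : {set V}) : (#|A| <= k - 2)%N ->
    (deg (edges H) A)%:R <= (d * n) * n ^+ (k - 2 - #|A|).
  move=> Ak; apply: (@le_trans _ _ ((max_degree H (k - 2))%:R * n ^+ (k - 2 - #|A|))).
    by rewrite -natrX -natrM ler_nat deg_le_max_degree.
  by rewrite ler_wpM2r // exprn_ge0.
have B_gt0 : 0 < d * n by rewrite mulr_gt0.
have BM : d * n * M ^+ k.-1 <= t * n ^+ 2.
  apply: (@le_trans _ _ (d * n * (m * (2 * x)) ^+ k.-1)).
    rewrite ler_wpM2l ?(ltW B_gt0) // lerXn2r // nnegrE; first exact: le_trans M_ge1.
    by rewrite !mulr_ge0 // ltW.
  rewrite exprMn mE -/t le_eqVlt; apply/orP; left; apply/eqP; field.
  by rewrite gt_eqF.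
pose L := (4 * T ^ 3)%N.
pose Dn := (16 * k * (2 * T) ^ k.-1)%N.
have DE : 16 * k%:R * t = Dn%:R by rewrite /Dn !natrM natrX natrM.
have rare : L%:R * (16 * k%:R * t * (2 ^+ (k * L) * (16 * k%:R * t)) ^+ L) <= M / 16.
  rewrite DE ler_pdivlMr // mulrC; apply: (@le_trans _ _ m); last first.
    by apply: le_trans M_ge; rewrite ler_peMr // ltW.
  apply: le_trans m_large; rewrite -!natrX -!natrM -natrX -!natrM ler_nat.
  by have [T1 T2] := T_large; exact: violation_weight_le.
have [U [U_ge sparseU degU]] := sparsify k_ge4 N_gt0 uH B_gt0 M_ge1 t_ge1 degH BM rare.
have xk : 2000 * k%:R ^+ 3 * 10 ^+ k <= x by rewrite -!natrX -!natrM ler_nat.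
have q : x ^- 3 = (T ^ 3)%:R^-1 :> R by rewrite natrX.
have h1 := rate_small k_ge4 xk s_gt0 sE.
have h2 := round_loss_small k_ge4 xk s_gt0 sE.
have h3 := rate_le_survival k_ge4 xk s_gt0 sE.
rewrite q in h1 h2 h3.
have T3_gt0 : (0 < T ^ 3)%N by rewrite expn_gt0 T_gt0.
have T3L : ((T ^ 3).+1.*2 <= L)%N by rewrite /L; clear - T3_gt0; lia.
have g_ge0 : 0 <= s / x by rewrite divr_ge0 // ltW.
have uU e : e \in induced (edges H) U -> #|e| = k by rewrite inE => /andP[/uH].
have [I [IU indI cardI]] :=
  exists_independent T3_gt0 k_ge4 uU sparseU T3L g_ge0 h1 degU h2 h3 U.
have Iind : independent H I.
  apply/forall_inP => e eH; apply/negP => eI.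
  by have := indI e; rewrite inE eH (subset_trans eI IU) eI => /(_ isT).
apply: (@le_trans _ _ #|I|%:R); last first.
  by rewrite ler_nat; apply: (@leq_bigmax_cond _ (independent H) (fun A : {set V} => #|A|)).
apply: le_trans cardI; apply: (@le_trans _ _ (s / x * (m * x / 2))).
  rewrite le_eqVlt; apply/orP; left; apply/eqP.
  by field; rewrite gt_eqF.
by rewrite ler_wpM2l //; apply: le_trans U_ge; rewrite ler_wpM2r ?invr_ge0.
Qed.

End LowerBound.

(** * Choice of the scale *)

Lemma alpha_ge1 (k : nat) (V : finType) (H : kgraph k V) :
  (2 <= k)%N -> (0 < #|V|)%N -> (1 <= alpha H)%N.
Proof.
move=> k2 /card_gt0P[v _]; rewrite -(cards1 v).
apply: (@leq_bigmax_cond _ (independent H) (fun A : {set V} => #|A|)).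
apply/forall_inP => e eH; apply/negP => /subset_leq_card.
by rewrite cards1 (eqP (forall_inP (edges_uniform H) e eH)) leqNgt k2.
Qed.

Lemma powR_root (R : realType) (y : R) (r : nat) : (0 < r)%N -> 0 <= y ->
  (y `^ (1 / r%:R)) ^+ r = y.
Proof.
move=> r0 y0; rewrite -powR_mulrn ?powR_ge0 // -powRrM mul1r mulVf ?powRr1 //.
by rewrite pnatr_eq0 -lt0n.
Qed.

(** Maximality makes [T] comparable with a power of [ln X], so that [ln T] is of the
    order of the iterated logarithm. *)
Lemma largest_scale (R : realType) (a T0 : nat) (X : R) : (0 < a)%N ->
  (2 ^ (a * T0 ^ 6))%:R <= X ->
  exists T : nat, [/\ (T0 <= T)%N, (2 ^ (a * T ^ 6))%:R <= X &
    X < (2 ^ (a * T.+1 ^ 6))%:R].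
Proof.
move=> a0 h0; pose P T := (2 ^ (a * T ^ 6))%:R <= X.
have exP : exists T, P T by exists T0.
have X0 : 0 <= X by apply: le_trans h0; exact: ler0n.
have bP T : P T -> (T <= Num.truncn X)%N.
  move=> PT; rewrite truncn_ge_nat //; apply: le_trans PT; rewrite ler_nat.
  apply: leq_trans (ltnW (ltn_expl _ (leqnn 2))) _; rewrite leq_exp2l //.
  case: T => // T; apply: (@leq_trans (1 * T.+1 ^ 6)); last by rewrite leq_mul2r a0 orbT.
  by rewrite mul1n -[leqLHS]expn1 leq_pexp2l.
case: (ex_maxnP exP bP) => T PT maxT; exists T; split=> //; first exact: maxT.
by rewrite ltNge; apply/negP => /maxT; rewrite ltnn.
Qed.

Lemma loglog_ge0 (R : realType) (X : R) : 0 <= loglog X.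
Proof. by rewrite /loglog le_max lexx. Qed.

Lemma loglog_le (R : realType) (X b : R) : 0 <= b -> ln (ln X) <= b -> loglog X <= b.
Proof. by move=> b0 h; rewrite /loglog ge_max b0. Qed.

Lemma loglog_le_id (R : realType) (X : R) : 1 < X -> loglog X <= X.
Proof.
move=> X1; have X0 : 0 < X by apply: lt_trans X1.
apply: loglog_le; first exact: ltW.
have l0 : 0 < ln X by rewrite ln_gt0.
exact: ltW (lt_trans (ln_sublinear l0) (ln_sublinear X0)).
Qed.

Lemma loglog_le_ln (R : realType) (a T : nat) (X : R) : 1 < X -> (0 < T)%N ->
  (128 * a <= T)%N -> X < (2 ^ (a * T.+1 ^ 6))%:R -> loglog X <= 7 * ln T%:R.
Proof.
move=> X1 T0 aT XT; have X0 : 0 < X by apply: lt_trans X1.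
have l0 : 0 < ln X by rewrite ln_gt0.
have T0R : 0 < T%:R :> R by rewrite ltr0n.
apply: loglog_le; first by rewrite mulr_ge0 // ln_ge0 // ler1n.
have -> : 7 * ln T%:R = ln (T%:R ^+ 7 : R) by rewrite lnXn // mulr_natl.
rewrite ler_ln ?posrE ?exprn_gt0 //.
apply: (@le_trans _ _ (ln ((2 ^ (a * T.+1 ^ 6))%:R : R))).
  by rewrite ler_ln ?posrE ?ltW // (lt_trans _ XT).
rewrite natrX lnXn ?ltr0n //.
apply: (@le_trans _ _ (2 *+ (a * T.+1 ^ 6))).
  by rewrite lerMn2r ltW ?orbT // ln_sublinear.
rewrite -mulrnA -natrX ler_nat.
apply: (@leq_trans (2 * (a * (2 * T) ^ 6))%N).
  by rewrite leq_mul2l leq_mul2l leq_exp2r //; apply/orP; right; apply/orP; right; clear - T0; lia.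
rewrite expnMn (expnS T 6); have := leq_mul aT (leqnn (T ^ 6)); set y := (T ^ 6)%N.
by rewrite (_ : 2 ^ 6 = 64)%N //; clear; lia.
Qed.

Theorem theorem1p4 (R : realType) (k : nat) (hk : (4 <= k)%N) :
  exists2 c : R, 0 < c &
  exists N : nat, forall (n : nat) (V : finType) (H : kgraph k V) (d : R),
    (N <= n)%N -> #|V| = n -> 0 < d < n%:R -> 1 <= d * n%:R ->
    (max_degree H (k - 2))%:R <= d * n%:R ->
    c * ((n%:R / d) * loglog (n%:R / d)) `^ (1 / (k - 1)%:R) <= (alpha H)%:R.
Proof.
(* [a] is dictated by [violation_weight_le], where [M] may be as small as the
   [(k - 1)]-st root of [n / d]; [T0] makes all numerical constraints hold. *)
pose a := (27 * k ^ 2)%N; pose T0 := (2000 * k ^ 3 * 10 ^ k)%N.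
pose X0 : R := (2 ^ (a * T0 ^ 6))%:R.
pose w : R := 128 * k%:R ^+ 2 * 8 ^+ k.-1.
pose r : R := 1 / (k - 1)%:R.
have r0 : 0 <= r by rewrite divr_ge0.
have k0 : (0 < k)%N by apply: leq_trans hk.
have w0 : 0 < w by rewrite !mulr_gt0 ?exprn_gt0 // ltr0n.
have X00 : 0 < X0 by rewrite ltr0n expn_gt0.
pose c1 := ((X0 * X0) `^ r)^-1; pose c2 := (2 * (7 * w) `^ r)^-1.
have c10 : 0 < c1 by rewrite invr_gt0 powR_gt0 // mulr_gt0.
have c20 : 0 < c2 by rewrite invr_gt0 mulr_gt0 // powR_gt0 // mulr_gt0.
exists (Num.min c1 c2); first by rewrite lt_min c10.
exists 0%N => n V H d _ <- /andP[d0 dn] dn1 degH.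
set X := _ / d.
have n0 : (0 < #|V|)%N by rewrite -(ltr0n R); apply: lt_trans dn.
have X1 : 1 < X by rewrite ltr_pdivlMr // mul1r.
have XP : 0 < X by apply: lt_trans X1.
have XL0 : 0 <= X * loglog X by rewrite mulr_ge0 ?loglog_ge0 // ltW.
rewrite -/r; set Y := _ `^ r.
have Y0 : 0 <= Y by exact: powR_ge0.
(* If [n / d] is bounded, then a single vertex is large enough. *)
case: (ltP X X0) => [XX0|X0X].
  apply: (@le_trans _ _ 1); last by rewrite ler1n alpha_ge1 //; clear - hk; lia.
  apply: (@le_trans _ _ (c1 * Y)); first by rewrite ler_wpM2r // ge_min lexx.
  rewrite /c1 mulrC ler_pdivrMr ?powR_gt0 ?mulr_gt0 // mul1r.
  apply: ge0_ler_powR => //; rewrite ?nnegrE ?mulr_ge0 ?(ltW X00) //.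
  apply: ler_pM; rewrite ?loglog_ge0 ?(ltW XP) ?(ltW XX0) //.
  exact: le_trans (loglog_le_id X1) (ltW XX0).
have [|T [T0T TX XT]] := largest_scale _ X0X.
  by rewrite /a muln_gt0 expn_gt0 k0.
have [T1 aT] : (1 < T)%N /\ (128 * a <= T)%N.
  have p10 : (10 <= 10 ^ k)%N by rewrite -[leqLHS]expn1 leq_pexp2l.
  have k2 : (k ^ 2 <= k ^ 3)%N by rewrite leq_pexp2l.
  have k20 : (0 < k ^ 2)%N by rewrite expn_gt0 k0.
  have := leq_mul k2 p10; rewrite /a; move: T0T k20; rewrite /T0 -mulnA.
  set y := (k ^ 2)%N; set z := (_ * _)%N; clear; lia.
have T00 : (0 < T)%N by exact: ltnW.
have lnT0 : 0 < ln T%:R :> R by rewrite ln_gt0 // ltr1n.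
have k10 : (0 < k - 1)%N by clear - hk; lia.
pose m := X `^ r; pose s := (ln (T%:R : R) / w) `^ r.
have sw0 : 0 < ln (T%:R : R) / w by rewrite divr_gt0.
have mE : m ^+ k.-1 = #|V|%:R / d by rewrite -subn1 powR_root // ltW.
have sE : s ^+ k.-1 * (128 * k%:R ^+ 2 * 8 ^+ k.-1) = ln T%:R.
  by rewrite -subn1 powR_root ?(ltW sw0) // subn1 divfK // gt_eqF.
apply: le_trans (alpha_ge_scale hk d0 dn1 degH (powR_ge0 _ _) mE T0T TX (powR_gt0 _ sw0) sE).
rewrite -/m -/s; apply: (@le_trans _ _ (c2 * Y)); first by rewrite ler_wpM2r // ge_min lexx orbT.
have -> : m * s / 2 = c2 * ((7 * w) `^ r * (m * s)).
  by rewrite /c2; field; rewrite gt_eqF // powR_gt0 // mulr_gt0.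
rewrite ler_wpM2l ?(ltW c20) //.
have XP0 := ltW XP; have lT0 := ltW lnT0; have swl0 := ltW sw0.
have w70 : 0 <= 7 * w by apply: mulr_ge0 => //; exact: ltW.
have -> : (7 * w) `^ r * (m * s) = (X * (7 * ln T%:R)) `^ r.
  rewrite /m /s -powRM // -powRM //; last by rewrite mulr_ge0.
  by congr (_ `^ _); field; rewrite gt_eqF.
have lT70 : 0 <= 7 * ln (T%:R : R) by rewrite mulr_ge0.
apply: ge0_ler_powR => //; first by rewrite nnegrE mulr_ge0.
by rewrite ler_wpM2l // (loglog_le_ln X1 T00 aT XT).
Qed.
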